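(* Let $A,B,C$ be $C^1$ functions on $[0,1]$, let $h(t,x)=A(t)x^3+B(t)x^2+C(t)x$, and consider the Abel equation $dx/dt=h(t,x)$ on the strip $\mathcal{S}=[0,1]\times\mathbb{R}$. Suppose there exist $w\in\mathbb{R}$ and a $C^1$ function $f(t,x)$, $1$-periodic in $t$, such that $$M_w(t,x):=\langle\nabla f(t,x),(1,h(t,x))\rangle+w\,f(t,x)\operatorname{div}(1,h(t,x))$$ does not change sign in $\mathcal{S}$ and vanishes only on a set of zero Lebesgue measure which is not invariant under the flow. Let $K_1$ denote the number of curves in $\{f=0\}$ joining $t=0$ and $t=1$, and let $K_2\le K_1$ be the number of these curves which are invariant under the flow. Then the Abel equation has at most $K_1+K_2+1$ periodic orbits. Moreover, all periodic orbits not contained in $\{f=0\}$ do not intersect this set, are hyperbolic, and their stability is given by the sign of $w f(t,x)M_w(t,x)$ on each of them.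
   Context: A periodic orbit is a solution $x(t)$ defined on all of $[0,1]$ with $x(0)=x(1)$. The Poincaré map is $\Pi(x_0)=x(1;x_0)$ where $x(t;x_0)$ is the solution with $x(0;x_0)=x_0$; a periodic orbit with initial condition $x_0$ is hyperbolic if $\Pi'(x_0)\ne1$. $\nabla$ and $\operatorname{div}$ are taken in the variables $(t,x)$, so $\operatorname{div}(1,h)=\partial h/\partial x$.
   Formalization: ''Not invariant under the flow'' is taken to mean that every flow-invariant set contained in the zero set of M_w lies in {f=0}; taken literally the claim fails, e.g. for A=(t-1/2)^2, B=C=0, f=1, w=1, where the orbit x=0 is not hyperbolic. *)

(* Defs.v *)
From Stdlib Require Import Reals List.
From Coquelicot Require Import Coquelicot.
Open Scope R_scope.

Definition in01 (t : R) : Prop := 0 <= t <= 1.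

Definition abel (A B C : R -> R) (t x : R) : R :=
  A t * x ^ 3 + B t * x ^ 2 + C t * x.

Definition is_interval (I : R -> Prop) : Prop :=
  forall a b c, I a -> I c -> a <= b -> b <= c -> I b.

Definition has_deriv_within (D : R -> Prop) (g : R -> R) (t l : R) : Prop :=
  filterlim (fun s => (g s - g t) / (s - t))
    (within (fun s => D s /\ s <> t) (locally t)) (locally l).

Definition C1_on01 (g : R -> R) : Prop :=
  exists g' : R -> R,
    (forall t, in01 t -> has_deriv_within in01 g t (g' t)) /\
    (forall t, in01 t -> filterlim g' (within in01 (locally t)) (locally (g' t))).

Definition dt (f : R -> R -> R) (t x : R) : R := Derive (fun s => f s x) t.
Definition dx (f : R -> R -> R) (t x : R) : R := Derive (fun y => f t y) x.

Definition C1_2d (f : R -> R -> R) : Prop :=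
  forall t x,
    ex_derive (fun s => f s x) t /\ ex_derive (fun y => f t y) x /\
    continuous (fun p : R * R => dt f (fst p) (snd p)) (t, x) /\
    continuous (fun p : R * R => dx f (fst p) (snd p)) (t, x).

Definition periodic1 (f : R -> R -> R) : Prop :=
  forall t x, f (t + 1) x = f t x.

(** M_w = <grad f, (1,h)> + w f div(1,h), with div(1,h) = dh/dx. *)
Definition Mw (h f : R -> R -> R) (w t x : R) : R :=
  (dt f t x * 1 + dx f t x * h t x) + w * f t x * dx h t x.

Definition sol (h : R -> R -> R) (I : R -> Prop) (x : R -> R) : Prop :=
  is_interval I /\ (forall t, I t -> in01 t) /\
  forall t, I t -> has_deriv_within I x t (h t (x t)).

Definition invariant (h : R -> R -> R) (P : R * R -> Prop) : Prop :=
  (forall p, P p -> in01 (fst p)) /\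
  forall I x, sol h I x -> forall t0 t1, I t0 -> I t1 ->
    P (t0, x t0) -> P (t1, x t1).

Definition null2 (Z : R * R -> Prop) : Prop :=
  forall eps, 0 < eps ->
    exists a b c d : nat -> R,
      (forall n, a n <= b n /\ c n <= d n) /\
      (forall p, Z p -> exists n, a n <= fst p <= b n /\ c n <= snd p <= d n) /\
      (forall N, sum_f_R0 (fun n => (b n - a n) * (d n - c n)) N < eps).

Definition connected2 (K : R * R -> Prop) : Prop :=
  forall U V : R * R -> Prop, open U -> open V ->
    (forall p, K p -> U p \/ V p) ->
    (exists p, K p /\ U p) -> (exists p, K p /\ V p) ->
    exists p, K p /\ U p /\ V p.

Definition conn (Z : R * R -> Prop) (p q : R * R) : Prop :=
  exists K, connected2 K /\ (forall r, K r -> Z r) /\ K p /\ K q.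

Definition comp (Z : R * R -> Prop) (p : R * R) : R * R -> Prop := conn Z p.

Definition ncomp (Z : R * R -> Prop) (Q : (R * R -> Prop) -> Prop) (n : nat)
  : Prop :=
  exists reps : list (R * R),
    length reps = n /\
    (forall p, In p reps -> Z p /\ Q (comp Z p)) /\
    (forall i j p q, nth_error reps i = Some p -> nth_error reps j = Some q ->
       i <> j -> ~ conn Z p q) /\
    (forall p, Z p -> Q (comp Z p) -> exists r, In r reps /\ conn Z r p).

Definition joins01 (K : R * R -> Prop) : Prop :=
  (exists p, K p /\ fst p = 0) /\ (exists p, K p /\ fst p = 1).

Definition periodic_ic (h : R -> R -> R) (x0 : R) : Prop :=
  exists u, sol h in01 u /\ u 0 = x0 /\ u 1 = x0.

Definition poincare (h : R -> R -> R) (y z : R) : Prop :=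
  exists u, sol h in01 u /\ u 0 = y /\ u 1 = z.

Definition poincare_deriv (h : R -> R -> R) (x0 d : R) : Prop :=
  (exists del, 0 < del /\ forall y, Rabs (y - x0) < del -> exists z, poincare h y z) /\
  forall eps, 0 < eps -> exists del, 0 < del /\
    forall y z z0, 0 < Rabs (y - x0) < del -> poincare h x0 z0 -> poincare h y z ->
      Rabs ((z - z0) / (y - x0) - d) < eps.

Definition hyperbolic (h : R -> R -> R) (x0 : R) : Prop :=
  exists d, poincare_deriv h x0 d /\ d <> 1.

(* Main.v *)
(** Replacing [f] by [-f], assume [M_w >= 0]. Along a solution [u],
    [f(t,u) exp (w int div)] has derivative [M_w exp (w int div) >= 0], so the
    sign of [f] can only increase. On a periodic orbit [f] therefore vanishes
    identically or nowhere, and in the second case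
    [f (exp (w int div) - 1) > 0] while [Pi' = exp (int div)]: the orbit is
    hyperbolic, with stability given by the sign of [w f].

    Between two periodic orbits on which [f] does not vanish there is a
    component of [{f = 0}] joining [t = 0] to [t = 1]. If [f] has opposite signs
    on them, then in flow coordinates the zero set meets every trajectory of a
    whole band in a nonempty time interval, and such a band is connected. If the
    signs agree, both orbits have the same stability, so that some periodic
    orbit in between is either contained in [{f = 0}] or has the other sign.
    Hence at most [K1 + 1] periodic orbits avoid [{f = 0}].

    If a periodic orbit [u] lies in [{f = 0}], then its graph is a whole component:
    otherwise all arcs near [u] on one side meet [{f = 0}], which forces
    [f(0,y) <= 0 <= f(0,Pi y)] there, hence [f = 0] on an open set, against the
    nullity of [{M_w = 0}]. So there are at most [K2] such orbits. *)

Require Import Defs.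
From Stdlib Require Import Reals List Lra Lia Permutation.
From Stdlib Require Import ClassicalEpsilon FunctionalExtensionality PropExtensionality.
From Coquelicot Require Import Coquelicot.
Open Scope R_scope.

(** The cubic may blow up before time 1, so the flow over [[0,1]] is not defined everywhere. It is
    used only where it exists: near a solution defined on [[0,1]], and between two such solutions,
    which act as barriers. Smooth dependence on initial values is replaced by one exact identity,
    [sol_diff]: the difference of two solutions is multiplied by [exp k], with [k] the integral of
    the secant slope [abel_quot]. It yields uniqueness, order, Lipschitz dependence and the formula
    for the derivative of the Poincaré map. The strict inequality behind hyperbolicity comes from
    applying the non-invariance hypothesis to the graph of one solution: if [M_w] vanished along it,
    the graph would be an invariant set of zeros of [M_w], hence would lie in [{f = 0}]. The set
    [{f = 0}] is treated as a bare closed set. Its curves are connected components, and the graph of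
    a solution on which [f] does not vanish is a wall that no component crosses. *)

(** * Functions on a segment: continuity, one-sided derivatives, integrals *)

Definition clamp (p q t : R) : R := Rmax p (Rmin q t).

Lemma clamp_in p q t : p <= q -> p <= clamp p q t <= q.
Proof.
  intros H; unfold clamp, Rmax, Rmin.
  destruct (Rle_dec q t), (Rle_dec p _); lra.
Qed.

Lemma clamp_id p q t : p <= t <= q -> clamp p q t = t.
Proof.
  intros H; unfold clamp, Rmax, Rmin.
  destruct (Rle_dec q t), (Rle_dec p _); lra.
Qed.

Lemma clamp_lip p q s t : Rabs (clamp p q s - clamp p q t) <= Rabs (s - t).
Proof.
  unfold clamp, Rmax, Rmin.
  destruct (Rle_dec q s), (Rle_dec q t); repeat destruct (Rle_dec p _);
    unfold Rabs; repeat destruct (Rcase_abs _); lra.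
Qed.

Lemma continuous_eps (g : R -> R) (t : R) :
  continuous g t <->
  forall eps, 0 < eps -> exists del, 0 < del /\
    forall s, Rabs (s - t) < del -> Rabs (g s - g t) < eps.
Proof.
  split.
  - intros H eps He.
    destruct (proj1 (filterlim_locally _ _) H (mkposreal eps He)) as [d Hd].
    exists d; split; [apply cond_pos|]. intros s Hs; apply (Hd s Hs).
  - intros H; apply filterlim_locally; intros eps.
    destruct (H eps (cond_pos eps)) as [d [Hd1 Hd2]].
    exists (mkposreal d Hd1); intros s Hs; apply (Hd2 s Hs).
Qed.

Lemma continuous_clamp p q t : continuous (clamp p q) t.
Proof.
  apply continuous_eps; intros eps He; exists eps; split; [exact He|].
  intros s Hs; eapply Rle_lt_trans; [apply clamp_lip | exact Hs].
Qed.

Lemma has_deriv_within_eps D g t l :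
  has_deriv_within D g t l <->
  forall eps, 0 < eps -> exists del, 0 < del /\
    forall s, D s -> s <> t -> Rabs (s - t) < del ->
      Rabs ((g s - g t) / (s - t) - l) < eps.
Proof.
  unfold has_deriv_within; split.
  - intros H eps He.
    destruct (proj1 (filterlim_locally _ _) H (mkposreal eps He)) as [d Hd].
    exists d; split; [apply cond_pos|]. intros s Ds Hst Hs.
    apply (Hd s Hs (conj Ds Hst)).
  - intros H; apply filterlim_locally; intros eps.
    destruct (H eps (cond_pos eps)) as [d [Hd1 Hd2]].
    exists (mkposreal d Hd1); intros s Hs [Ds Hst]; apply (Hd2 s Ds Hst Hs).
Qed.

Lemma has_deriv_within_subset (D E : R -> Prop) g t l :
  (forall s, D s -> E s) -> has_deriv_within E g t l -> has_deriv_within D g t l.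
Proof.
  rewrite !has_deriv_within_eps; intros DE H eps He.
  destruct (H eps He) as [d [Hd1 Hd2]]; exists d; auto.
Qed.

Lemma has_deriv_within_of_is_derive (D : R -> Prop) g t l :
  is_derive g t l -> has_deriv_within D g t l.
Proof.
  intros H; apply is_derive_Reals in H.
  apply has_deriv_within_eps; intros eps He.
  destruct (H eps He) as [d Hd].
  exists d; split; [apply cond_pos|]; intros s _ Hst Hs.
  specialize (Hd (s - t)). replace (t + (s - t)) with s in Hd by ring.
  apply Hd; [lra | exact Hs].
Qed.

Lemma has_deriv_within_ext (D : R -> Prop) g g' t l :
  (forall s, D s -> g s = g' s) -> D t ->
  has_deriv_within D g t l -> has_deriv_within D g' t l.
Proof.
  rewrite !has_deriv_within_eps; intros E Dt H eps He.
  destruct (H eps He) as [d [Hd1 Hd2]]; exists d; split; [exact Hd1|].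
  intros s Ds Hst Hs; rewrite <- (E s Ds), <- (E t Dt); auto.
Qed.

(** A derivative within a segment says nothing about values outside it. Composing with the
    projection [clamp] gives a total continuous function, the form to which integrals and the mean
    value theorem are applied. *)
Lemma clamp_continuous_of_deriv p q g g' :
  p <= q ->
  (forall t, p <= t <= q -> has_deriv_within (fun s => p <= s <= q) g t (g' t)) ->
  forall t, continuous (fun s => g (clamp p q s)) t.
Proof.
  intros pq H t; set (c := clamp p q t).
  assert (Hc : p <= c <= q) by (apply clamp_in; exact pq).
  apply continuous_eps; intros eps He.
  destruct (proj1 (has_deriv_within_eps _ _ _ _) (H c Hc) 1 Rlt_0_1)
    as [d [Hd1 Hd2]].
  (* Within [d] of [c] the difference quotient is within 1 of [g' c], so [L] bounds it there. *)
  set (L := Rabs (g' c) + 1).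
  assert (HL : 0 < L) by (unfold L; generalize (Rabs_pos (g' c)); lra).
  exists (Rmin d (eps / L)); split.
  { apply Rmin_pos; [exact Hd1 | apply Rdiv_lt_0_compat; lra]. }
  intros s Hs; fold c.
  set (e := clamp p q s).
  assert (Hes : Rabs (e - c) <= Rabs (s - t)) by apply clamp_lip.
  assert (H1 : Rabs (e - c) < d)
    by (generalize (Rmin_l d (eps / L)); lra).
  assert (H2 : Rabs (e - c) < eps / L)
    by (generalize (Rmin_r d (eps / L)); lra).
  destruct (Req_dec e c) as [E|E].
  { rewrite E, Rminus_diag, Rabs_R0; exact He. }
  specialize (Hd2 e (clamp_in p q s pq) E H1).
  assert (H3 : Rabs ((g e - g c) / (e - c)) <= L).
  { unfold L.
    replace ((g e - g c) / (e - c))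
      with (((g e - g c) / (e - c) - g' c) + g' c) by ring.
    eapply Rle_trans; [apply Rabs_triang|]; lra. }
  replace (g e - g c) with ((g e - g c) / (e - c) * (e - c)) by (field; lra).
  rewrite Rabs_mult.
  apply Rle_lt_trans with (L * Rabs (e - c)).
  { apply Rmult_le_compat_r; [apply Rabs_pos | exact H3]. }
  apply Rlt_le_trans with (L * (eps / L)).
  { apply Rmult_lt_compat_l; assumption. }
  right; field; lra.
Qed.

Lemma clamp_is_derive p q g t l :
  p < t < q -> has_deriv_within (fun s => p <= s <= q) g t l ->
  is_derive (fun s => g (clamp p q s)) t l.
Proof.
  intros Ht H; apply is_derive_Reals; intros eps He.
  destruct (proj1 (has_deriv_within_eps _ _ _ _) H eps He) as [d [Hd1 Hd2]].
  assert (Hm : 0 < Rmin d (Rmin (t - p) (q - t)))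
    by (repeat apply Rmin_pos; lra).
  exists (mkposreal _ Hm); simpl; intros k Hk0 Hk.
  assert (K1 := Rmin_l d (Rmin (t - p) (q - t))).
  assert (K2 := Rmin_r d (Rmin (t - p) (q - t))).
  assert (K3 := Rmin_l (t - p) (q - t)).
  assert (K4 := Rmin_r (t - p) (q - t)).
  assert (Hr : p <= t + k <= q)
    by (unfold Rabs in Hk; destruct (Rcase_abs k); lra).
  rewrite !clamp_id by lra.
  specialize (Hd2 (t + k) Hr). replace (t + k - t) with k in Hd2 by ring.
  apply Hd2; lra.
Qed.

Lemma continuous_continuity_pt (g : R -> R) t : continuous g t -> continuity_pt g t.
Proof. intros H; apply continuity_pt_filterlim; exact H. Qed.

Lemma nondecreasing_of_deriv (g dg : R -> R) p q :
  p <= q -> (forall t, continuous g t) ->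
  (forall t, p < t < q -> is_derive g t (dg t)) ->
  (forall t, p < t < q -> 0 <= dg t) -> g p <= g q.
Proof.
  intros pq Hc Hd Hp.
  (* [MVT_gen] returns a point of the closed segment, and [dg] may be negative at the ends; [dg'] is
     not. *)
  set (dg' := fun t => Rmax 0 (dg t)).
  destruct (MVT_gen g p q dg') as [c [Hc1 Hc2]].
  - intros x; rewrite Rmin_left, Rmax_right by lra; intros Hx.
    unfold dg'; rewrite Rmax_right by (apply Hp; exact Hx); apply Hd; exact Hx.
  - intros; apply continuous_continuity_pt; auto.
  - assert (0 <= dg' c) by apply Rmax_l.
    assert (0 <= dg' c * (q - p)) by (apply Rmult_le_pos; lra). lra.
Qed.

Lemma constant_of_deriv (g : R -> R) p q :
  p <= q -> (forall t, continuous g t) ->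
  (forall t, p < t < q -> is_derive g t 0) -> g p = g q.
Proof.
  intros pq Hc Hd; apply Rle_antisym.
  - apply (nondecreasing_of_deriv g (fun _ => 0)); auto; intros; lra.
  - apply Ropp_le_cancel.
    apply (nondecreasing_of_deriv (fun t => - g t) (fun _ => - 0)); auto.
    + intros t; apply (continuous_opp g); auto.
    + intros t Ht; apply (is_derive_opp g t 0); auto.
    + intros; lra.
Qed.

Lemma continuous_Rmult (g k : R -> R) t :
  continuous g t -> continuous k t -> continuous (fun s => g s * k s) t.
Proof. intros; apply (continuous_mult g k); assumption. Qed.

Lemma continuous_Rplus (g k : R -> R) t :
  continuous g t -> continuous k t -> continuous (fun s => g s + k s) t.
Proof. intros; apply (continuous_plus g k); assumption. Qed.

Lemma continuous_Rminus (g k : R -> R) t :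
  continuous g t -> continuous k t -> continuous (fun s => g s - k s) t.
Proof. intros; apply (continuous_minus g k); assumption. Qed.

Lemma continuous_exp_comp (g : R -> R) t :
  continuous g t -> continuous (fun s => exp (g s)) t.
Proof. intros H; apply continuous_comp; [exact H | apply continuous_exp]. Qed.

Lemma is_derive_RInt_continuous (k : R -> R) p t :
  (forall s, continuous k s) -> is_derive (fun t => RInt k p t) t (k t).
Proof.
  intros Hk; apply (is_derive_RInt k _ p); [|apply Hk].
  apply filter_forall; intros b; apply (@RInt_correct R_CompleteNormedModule).
  apply (@ex_RInt_continuous R_CompleteNormedModule); auto.
Qed.

Lemma ex_RInt_cont (k : R -> R) p q : (forall s, continuous k s) -> ex_RInt k p q.
Proof. intros; apply (@ex_RInt_continuous R_CompleteNormedModule); auto. Qed.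

Lemma continuous_RInt_upper (k : R -> R) p t :
  (forall s, continuous k s) -> continuous (fun t => RInt k p t) t.
Proof.
  intros Hk. apply (@ex_derive_continuous R_AbsRing R_NormedModule).
  eexists; apply is_derive_RInt_continuous; exact Hk.
Qed.

Lemma RInt_close (k g : R -> R) p q M :
  p <= q -> (forall s, continuous k s) -> (forall s, continuous g s) ->
  (forall t, p <= t <= q -> Rabs (k t - g t) <= M) ->
  Rabs (RInt k p q - RInt g p q) <= (q - p) * M.
Proof.
  intros pq Hk Hg H.
  replace (RInt k p q - RInt g p q) with (RInt (fun x => k x - g x) p q)
    by (apply (RInt_minus k g); apply ex_RInt_cont; auto).
  apply abs_RInt_le_const; auto.
  apply ex_RInt_cont; intros; apply (continuous_minus k g); auto.
Qed.

(** * Differences of two solutions: uniqueness and order *)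

Definition ext01 (g : R -> R) : R -> R := fun t => g (clamp 0 1 t).

Definition continuous01 (g : R -> R) : Prop := forall t, continuous (ext01 g) t.

Lemma ext01_id g t : in01 t -> ext01 g t = g t.
Proof. intros H; unfold ext01; rewrite clamp_id; auto. Qed.

Lemma C1_continuous01 g : C1_on01 g -> continuous01 g.
Proof.
  intros [g' [H _]] t. apply (clamp_continuous_of_deriv 0 1 g g'); [lra|].
  exact H.
Qed.

(* Difference quotient of the cubic [abel A B C t] between [x] and [y]. *)
Definition abel_quot (A B C : R -> R) (t x y : R) : R :=
  A t * (y ^ 2 + y * x + x ^ 2) + B t * (y + x) + C t.

Lemma abel_quotE A B C t x y :
  abel A B C t y - abel A B C t x = (y - x) * abel_quot A B C t x y.
Proof. unfold abel, abel_quot; ring. Qed.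

Lemma continuous_abel_quot (A B C u v : R -> R) t :
  continuous A t -> continuous B t -> continuous C t ->
  continuous u t -> continuous v t ->
  continuous (fun s => abel_quot A B C s (u s) (v s)) t.
Proof.
  intros; unfold abel_quot; simpl.
  repeat first [assumption | apply continuous_const
               | apply continuous_Rplus | apply continuous_Rmult].
Qed.

Lemma continuous_abel (A B C u : R -> R) t :
  continuous A t -> continuous B t -> continuous C t -> continuous u t ->
  continuous (fun s => abel A B C s (u s)) t.
Proof.
  intros; unfold abel; simpl.
  repeat first [assumption | apply continuous_const
               | apply continuous_Rplus | apply continuous_Rmult].
Qed.

Lemma sol_subset h (I J : R -> Prop) x :
  is_interval J -> (forall t, J t -> I t) -> sol h I x -> sol h J x.
Proof.
  intros HJ JI [_ [H2 H3]]; split; [exact HJ|split; [auto|]].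
  intros t Ht; apply has_deriv_within_subset with I; auto.
Qed.

Lemma is_interval_closed p q : is_interval (fun t => p <= t <= q).
Proof. intros a b c; simpl; lra. Qed.

Lemma sol_restrict h I x p q :
  sol h I x -> I p -> I q -> sol h (fun t => p <= t <= q) x.
Proof.
  intros H Ip Iq; apply sol_subset with I; auto using is_interval_closed.
  intros t Ht; apply (proj1 H p t q); tauto.
Qed.

Lemma sol_continuous h p q x t :
  p <= q -> sol h (fun t => p <= t <= q) x ->
  continuous (fun s => x (clamp p q s)) t.
Proof.
  intros pq [_ [_ H]].
  apply (clamp_continuous_of_deriv p q x (fun t => h t (x t)) pq H).
Qed.

Lemma sol_is_derive h p q x t :
  p < t < q -> sol h (fun t => p <= t <= q) x ->
  is_derive (fun s => x (clamp p q s)) t (h t (x t)).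
Proof. intros pq [_ [_ H]]; apply clamp_is_derive; [lra | apply H; lra]. Qed.

(* The difference of two solutions solves a scalar linear equation; [k] is the
   integral of its coefficient, here compared with the integral of any [g]. *)
Lemma sol_diff A B C p q u v :
  continuous01 A -> continuous01 B -> continuous01 C -> 0 <= p <= q -> q <= 1 ->
  sol (abel A B C) (fun t => p <= t <= q) u ->
  sol (abel A B C) (fun t => p <= t <= q) v ->
  exists k, v q - u q = (v p - u p) * exp k /\
    forall g M, (forall t, continuous g t) ->
      (forall t, p <= t <= q -> Rabs (abel_quot A B C t (u t) (v t) - g t) <= M) ->
      Rabs (k - RInt g p q) <= (q - p) * M.
Proof.
  intros HA HB HC Hp Hq Hu Hv.
  set (U := fun s => u (clamp p q s)). set (V := fun s => v (clamp p q s)).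
  assert (cU : forall t, continuous U t)
    by (intros; apply (sol_continuous (abel A B C) p q u); [lra | exact Hu]).
  assert (cV : forall t, continuous V t)
    by (intros; apply (sol_continuous (abel A B C) p q v); [lra | exact Hv]).
  set (k := fun s => abel_quot (ext01 A) (ext01 B) (ext01 C) s (U s) (V s)).
  assert (ck : forall t, continuous k t)
    by (intros; apply continuous_abel_quot; auto).
  assert (kE : forall t, p <= t <= q -> k t = abel_quot A B C t (u t) (v t)).
  { intros t Ht; unfold k, U, V, abel_quot.
    rewrite !ext01_id by (split; lra). rewrite !clamp_id by lra. reflexivity. }
  exists (RInt k p q); split.
  (* Integrating factor: [V - U] solves a linear equation with coefficient [k], so [phi] has
     derivative 0. *)
  - set (phi := fun t => (V t - U t) * exp (- RInt k p t)).
    assert (E : phi p = phi q).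
    { apply constant_of_deriv; [lra| |].
      - intros t; apply continuous_Rmult; [apply continuous_Rminus; auto|].
        apply continuous_exp_comp, (continuous_opp (fun t => RInt k p t)).
        apply continuous_RInt_upper; auto.
      - intros t Ht.
        assert (dU := sol_is_derive (abel A B C) p q u t Ht Hu).
        assert (dV := sol_is_derive (abel A B C) p q v t Ht Hv).
        assert (dk := is_derive_RInt_continuous k p t ck).
        assert (dE : is_derive (fun t => exp (- RInt k p t)) t
                       (- k t * exp (- RInt k p t))).
        { apply (is_derive_comp exp (fun t => - RInt k p t)).
          - apply is_derive_exp.
          - apply (is_derive_opp (fun t => RInt k p t)); exact dk. }
        assert (dVU := is_derive_minus V U t _ _ dV dU).
        assert (P := is_derive_mult (fun t => V t - U t) _ t _ _ dVU dE Rmult_comm).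
        replace 0 with (plus (mult (minus (abel A B C t (v t)) (abel A B C t (u t)))
               (exp (- RInt k p t)))
             (mult (V t - U t) (- k t * exp (- RInt k p t)))); [exact P|].
        unfold plus, mult, minus, plus, opp; simpl.
        rewrite kE by lra.
        replace (abel A B C t (v t) + - abel A B C t (u t)) with
          ((v t - u t) * abel_quot A B C t (u t) (v t))
          by (rewrite <- abel_quotE; ring).
        unfold U, V; rewrite !clamp_id by lra; ring. }
    unfold phi, U, V in E. rewrite !clamp_id in E by lra.
    rewrite RInt_point in E. unfold zero in E; simpl in E.
    rewrite Ropp_0, exp_0, Rmult_1_r in E. rewrite E.
    rewrite Rmult_assoc, <- exp_plus, Rplus_opp_l, exp_0; ring.
  - intros g M cg H; apply RInt_close; [lra|auto|auto|].
    intros t Ht; rewrite kE by exact Ht; apply H; exact Ht.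
Qed.

(** The factor [exp k] of [sol_diff] never vanishes, so a difference that is 0 at one time is 0 both
    later and earlier. *)
Lemma sol_unique_at A B C I u x s t :
  continuous01 A -> continuous01 B -> continuous01 C ->
  sol (abel A B C) I u -> sol (abel A B C) I x ->
  I s -> I t -> x s = u s -> x t = u t.
Proof.
  intros HA HB HC Hu Hx Is It E.
  assert (s01 := proj1 (proj2 Hu) s Is). assert (t01 := proj1 (proj2 Hu) t It).
  unfold in01 in *.
  destruct (Rle_dec s t) as [l|l].
  - destruct (sol_diff A B C s t u x) as [k [Hk _]];
      try lra; try assumption; try (apply sol_restrict with I; assumption).
    rewrite E in Hk; lra.
  - destruct (sol_diff A B C t s u x) as [k [Hk _]];
      try lra; try assumption; try (apply sol_restrict with I; assumption).
    rewrite E, Rminus_diag in Hk. symmetry in Hk.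
    apply Rmult_integral in Hk; generalize (exp_pos k); lra.
Qed.

Lemma sol_order A B C u v t :
  continuous01 A -> continuous01 B -> continuous01 C ->
  sol (abel A B C) in01 u -> sol (abel A B C) in01 v -> in01 t ->
  (u 0 < v 0 <-> u t < v t).
Proof.
  intros HA HB HC Hu Hv Ht.
  assert (H0 : in01 0) by (split; lra).
  destruct (sol_diff A B C 0 t u v) as [k [Hk _]];
    try (unfold in01 in Ht; lra); try assumption;
    try (apply sol_restrict with in01; assumption).
  assert (P := exp_pos k). split; intros H; nra.
Qed.

Lemma sol_order_le A B C u v t :
  continuous01 A -> continuous01 B -> continuous01 C ->
  sol (abel A B C) in01 u -> sol (abel A B C) in01 v -> in01 t ->
  (u 0 <= v 0 <-> u t <= v t).
Proof.
  intros HA HB HC Hu Hv Ht.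
  assert (H := sol_order A B C v u t HA HB HC Hv Hu Ht).
  split; intros; apply Rnot_lt_le; intros K; apply H in K; lra.
Qed.

(** * Existence of solutions *)

Lemma half_pow_small c eps : 0 <= c -> 0 < eps -> exists n, c * (/ 2) ^ n < eps.
Proof.
  intros Hc He.
  destruct (pow_lt_1_zero (/ 2)) with (y := eps / (c + 1)) as [n Hn].
  { rewrite Rabs_pos_eq; lra. }
  { apply Rdiv_lt_0_compat; lra. }
  exists n; specialize (Hn n (le_n n)).
  assert (P : 0 < (/ 2) ^ n) by (apply pow_lt; lra).
  rewrite Rabs_pos_eq in Hn by lra.
  apply Rmult_lt_compat_l with (r := c + 1) in Hn; [|lra].
  replace ((c + 1) * (eps / (c + 1))) with eps in Hn by (field; lra). lra.
Qed.

Lemma zero_of_half_pow x c : 0 <= c -> (forall n, Rabs x <= c * (/ 2) ^ n) -> x = 0.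
Proof.
  intros Hc H; destruct (Req_dec x 0) as [E|E]; [exact E|].
  destruct (half_pow_small c (Rabs x) Hc (Rabs_pos_lt x E)) as [n Hn].
  specialize (H n); lra.
Qed.

Lemma bounded01 (g : R -> R) :
  (forall t, continuous g t) -> exists M, 0 <= M /\ forall t, in01 t -> Rabs (g t) <= M.
Proof.
  intros Hg.
  destruct (continuity_ab_maj (fun t => Rabs (g t)) 0 1) as [m [Hm _]]; [lra| |].
  - intros c _; apply continuous_continuity_pt.
    apply (continuous_comp g Rabs); [apply Hg | apply continuous_Rabs].
  - exists (Rabs (g m)); split; [apply Rabs_pos | exact Hm].
Qed.

(** Effect of one Picard step on an error bound [c * exp (2 L t)]: it is halved. *)
Lemma RInt_exp_le c L t : 0 <= c -> 0 < L -> 0 <= t ->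
  RInt (fun s => L * (c * exp (2 * L * s))) 0 t <= c * / 2 * exp (2 * L * t).
Proof.
  intros Hc HL Ht.
  assert (H : is_RInt (fun s => L * (c * exp (2 * L * s))) 0 t
     (minus (c * / 2 * exp (2 * L * t)) (c * / 2 * exp (2 * L * 0)))).
  { apply (is_RInt_derive (fun s => c * / 2 * exp (2 * L * s))).
    - intros x _; auto_derive; [auto|field].
    - intros x _; apply (@ex_derive_continuous R_AbsRing R_NormedModule).
      auto_derive; auto. }
  rewrite (is_RInt_unique _ _ _ _ H).
  unfold minus, plus, opp; simpl. rewrite Rmult_0_r, exp_0. lra.
Qed.

Fixpoint picard_iter (G : R -> R -> R) (y : R) (n : nat) : R -> R :=
  match n with
  | O => fun _ => y
  | S n => fun t => y + RInt (fun s => G s (picard_iter G y n s)) 0 t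
  end.

Section Picard.

Context (G : R -> R -> R) (L y : R).
Context (L_pos : 0 < L)
  (G_lip : forall t a b, Rabs (G t a - G t b) <= L * Rabs (a - b))
  (G_cont : forall X : R -> R, (forall t, continuous X t) ->
     forall t, continuous (fun s => G s (X s)) t).

Lemma picard_step_continuous (X : R -> R) t :
  (forall s, continuous X s) ->
  continuous (fun t => y + RInt (fun s => G s (X s)) 0 t) t.
Proof.
  intros HX; apply continuous_Rplus; [apply continuous_const|].
  apply continuous_RInt_upper, G_cont, HX.
Qed.

Lemma picard_iter_continuous n t : continuous (picard_iter G y n) t.
Proof.
  revert t; induction n as [|n IH]; intros t; simpl.
  - apply continuous_const.
  - apply picard_step_continuous, IH.
Qed.

Lemma picard_step_close (X Y : R -> R) (g : R -> R) t :
  0 <= t -> (forall s, continuous X s) -> (forall s, continuous Y s) ->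
  (forall s, continuous g s) ->
  (forall s, 0 <= s <= t -> Rabs (X s - Y s) <= g s) ->
  Rabs ((y + RInt (fun s => G s (X s)) 0 t) - (y + RInt (fun s => G s (Y s)) 0 t))
    <= RInt (fun s => L * g s) 0 t.
Proof.
  intros Ht HX HY Hg H.
  assert (E : RInt (fun s => G s (X s) - G s (Y s)) 0 t =
              RInt (fun s => G s (X s)) 0 t - RInt (fun s => G s (Y s)) 0 t).
  { apply (RInt_minus (fun s => G s (X s)) (fun s => G s (Y s)));
      apply ex_RInt_cont, G_cont; assumption. }
  replace (_ - _) with (RInt (fun s => G s (X s) - G s (Y s)) 0 t)
    by (rewrite E; simpl; ring).
  assert (HD : forall s, continuous (fun s => G s (X s) - G s (Y s)) s).
  { intros s; apply continuous_Rminus; apply G_cont; assumption. }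
  eapply Rle_trans; [apply abs_RInt_le; [exact Ht | apply ex_RInt_cont, HD]|].
  apply RInt_le; [exact Ht| | |].
  - apply ex_RInt_cont; intros s.
    apply (continuous_comp (fun s => G s (X s) - G s (Y s)) Rabs);
      [apply HD | apply continuous_Rabs].
  - apply ex_RInt_cont; intros s; apply continuous_Rmult;
      [apply continuous_const | apply Hg].
  - intros s Hs; eapply Rle_trans; [apply G_lip|].
    apply Rmult_le_compat_l; [lra | apply H; lra].
Qed.

(* The weight [exp (2 L t)] makes the Picard step a contraction of ratio 1/2. *)
Lemma picard_iter_step M n t :
  (forall s, in01 s -> Rabs (picard_iter G y 1 s - picard_iter G y 0 s) <= M) ->
  0 <= M -> in01 t ->
  Rabs (picard_iter G y (S n) t - picard_iter G y n t)
    <= M * (/ 2) ^ n * exp (2 * L * t).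
Proof.
  intros HM M0; revert t; induction n as [|n IH]; intros t Ht.
  - eapply Rle_trans; [apply HM; exact Ht|].
    assert (1 <= exp (2 * L * t)).
    { rewrite <- exp_0; destruct Ht as [[t0|<-] _].
      - left; apply exp_increasing; nra.
      - replace (2 * L * 0) with 0 by ring; right; reflexivity. }
    simpl; nra.
  - eapply Rle_trans.
    + apply (picard_step_close (picard_iter G y (S n)) (picard_iter G y n)
        (fun s => M * (/ 2) ^ n * exp (2 * L * s))); [apply Ht | | | |].
      * apply picard_iter_continuous.
      * apply picard_iter_continuous.
      * intros s; apply (@ex_derive_continuous R_AbsRing R_NormedModule).
        auto_derive; auto.
      * intros s Hs; apply IH; split; [lra|]; destruct Ht; lra.
    + eapply Rle_trans; [apply RInt_exp_le; [|exact L_pos|apply Ht]|].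
      * apply Rmult_le_pos; [exact M0 | apply pow_le; lra].
      * right; simpl; ring.
Qed.

(** The factor [1 - (/ 2) ^ m] is the exact partial sum of the geometric series; with it the
    induction on [m] closes. *)
Lemma picard_iter_cauchy M n m t :
  (forall k, Rabs (picard_iter G y (S k) t - picard_iter G y k t) <= M * (/ 2) ^ k) ->
  Rabs (picard_iter G y (n + m) t - picard_iter G y n t)
    <= 2 * M * (/ 2) ^ n * (1 - (/ 2) ^ m).
Proof.
  intros H; induction m as [|m IH].
  - rewrite Nat.add_0_r, Rminus_diag, Rabs_R0; simpl; lra.
  - rewrite Nat.add_succ_r.
    replace (picard_iter G y (S (n + m)) t - picard_iter G y n t) with
      ((picard_iter G y (S (n + m)) t - picard_iter G y (n + m) t) +
       (picard_iter G y (n + m) t - picard_iter G y n t)) by ring.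
    eapply Rle_trans; [apply Rabs_triang|].
    specialize (H (n + m)%nat). rewrite pow_add in H.
    eapply Rle_trans; [apply Rplus_le_compat; [exact H | exact IH]|].
    right; simpl; field.
Qed.

Lemma picard_limit : exists X : R -> R, exists M, 0 <= M /\
  forall n t, in01 t -> Rabs (X t - picard_iter G y n t) <= M * (/ 2) ^ n.
Proof.
  destruct (bounded01 (fun s => picard_iter G y 1 s - picard_iter G y 0 s))
    as [M [M0 HM]].
  { intros t; apply continuous_Rminus; apply picard_iter_continuous. }
  (* On [[0,1]] the weight [exp (2 L t)] is at most [exp (2 L)]; absorbing it makes the bounds
     uniform in [t]. *)
  set (N := M * exp (2 * L)).
  assert (N0 : 0 <= N) by (apply Rmult_le_pos; [exact M0 | left; apply exp_pos]).
  assert (HN : forall k t, in01 t ->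
    Rabs (picard_iter G y (S k) t - picard_iter G y k t) <= N * (/ 2) ^ k).
  { intros k t Ht; eapply Rle_trans; [apply picard_iter_step; eassumption|].
    unfold N.
    assert (exp (2 * L * t) <= exp (2 * L)).
    { destruct Ht as [_ [Ht|Ht]].
      - left; apply exp_increasing; nra.
      - rewrite Ht, Rmult_1_r; right; reflexivity. }
    assert (0 <= M * (/ 2) ^ k)
      by (apply Rmult_le_pos; [exact M0 | apply pow_le; lra]). nra. }
  assert (HC : forall n m t, in01 t ->
    Rabs (picard_iter G y (n + m) t - picard_iter G y n t) <= 2 * N * (/ 2) ^ n).
  { intros n m t Ht; eapply Rle_trans; [apply picard_iter_cauchy; auto|].
    assert (0 <= (/ 2) ^ m) by (apply pow_le; lra).
    assert (0 <= 2 * N * (/ 2) ^ n)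
      by (apply Rmult_le_pos; [lra | apply pow_le; lra]). nra. }
  (* Convergence is known for [t] in [[0,1]] only. Elsewhere this value is arbitrary, and
     [picard_solution] discards it by [clamp]. *)
  exists (fun t => real (Lim_seq (fun n => picard_iter G y n t))), (2 * N).
  split; [lra|]. intros n t Ht.
  assert (E : ex_finite_lim_seq (fun n => picard_iter G y n t)).
  { apply ex_lim_seq_cauchy_corr. intros eps.
    destruct (half_pow_small (4 * N) eps) as [k Hk]; [lra | apply cond_pos|].
    exists k; intros i j Hi Hj.
    replace i with (k + (i - k))%nat by lia. replace j with (k + (j - k))%nat by lia.
    assert (Ai := HC k (i - k)%nat t Ht). assert (Aj := HC k (j - k)%nat t Ht).
    set (pi := picard_iter G y (k + (i - k)) t) in *.
    set (pj := picard_iter G y (k + (j - k)) t) in *.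
    set (pk := picard_iter G y k t) in *.
    apply Rabs_le_between in Ai; apply Rabs_le_between in Aj.
    apply Rabs_def1; lra. }
  apply Lim_seq_correct' in E. set (l := real _) in *.
  apply Rabs_le_between.
  assert (E' := proj1 (is_lim_seq_incr_n _ n l) E).
  assert (Hlo : Rbar_le (picard_iter G y n t - 2 * N * (/ 2) ^ n) l).
  { eapply is_lim_seq_le; [|apply is_lim_seq_const|exact E'].
    intros m. assert (A := HC n m t Ht). rewrite Nat.add_comm in A.
    apply Rabs_le_between in A; simpl; lra. }
  assert (Hhi : Rbar_le l (picard_iter G y n t + 2 * N * (/ 2) ^ n)).
  { eapply is_lim_seq_le; [|exact E'|apply is_lim_seq_const].
    intros m. assert (A := HC n m t Ht). rewrite Nat.add_comm in A.
    apply Rabs_le_between in A; simpl; lra. }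
  simpl in Hlo, Hhi; lra.
Qed.

Lemma picard_solution : exists Z : R -> R, Z 0 = y /\
  (forall t, continuous Z t) /\ forall t, in01 t -> is_derive Z t (G t (Z t)).
Proof.
  destruct picard_limit as [X [M [M0 HX]]].
  set (Y := fun t => X (clamp 0 1 t)).
  assert (cY : forall t, continuous Y t).
  { intros t; apply continuous_eps; intros eps He.
    destruct (half_pow_small M (eps / 3) M0) as [n Hn]; [lra|].
    assert (cn : continuous (fun s => picard_iter G y n (clamp 0 1 s)) t).
    { apply (continuous_comp (clamp 0 1)); [apply continuous_clamp|].
      apply picard_iter_continuous. }
    destruct (proj1 (continuous_eps _ _) cn (eps / 3)) as [d [d0 Hd]]; [lra|].
    exists d; split; [exact d0|]; intros s Hs; specialize (Hd s Hs).
    assert (A1 := HX n (clamp 0 1 s) ltac:(apply clamp_in; lra)).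
    assert (A2 := HX n (clamp 0 1 t) ltac:(apply clamp_in; lra)).
    unfold Y. apply Rabs_le_between in A1; apply Rabs_le_between in A2.
    apply Rabs_lt_between in Hd. apply Rabs_def1; lra. }
  (* One more Picard step applied to the limit. [Z] is differentiable on the whole line, two-sidedly
     even at 0 and 1, and equals [Y] on [[0,1]]. *)
  set (Z := fun t => y + RInt (fun s => G s (Y s)) 0 t).
  assert (ZY : forall t, in01 t -> Z t = Y t).
  { intros t Ht. apply Rminus_diag_uniq.
    assert (YX : forall s, in01 s -> Y s = X s)
      by (intros; unfold Y; rewrite clamp_id; auto).
    (* [L * M] from the distance of [Z] to iterate [n + 1], and [M] from the distance of that
       iterate to [Y]. *)
    apply zero_of_half_pow with ((L + 1) * M).
    { apply Rmult_le_pos; lra. }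
    intros n.
    assert (P0 : 0 <= (/ 2) ^ n) by (apply pow_le; lra).
    assert (A1 : Rabs (Z t - picard_iter G y (S n) t) <= L * (M * (/ 2) ^ n)).
    { eapply Rle_trans.
      - apply (picard_step_close Y (picard_iter G y n) (fun _ => M * (/ 2) ^ n));
          [apply Ht | exact cY | apply picard_iter_continuous
          | intros; apply continuous_const |].
        intros s Hs. assert (in01 s) by (destruct Ht; split; lra).
        rewrite YX by assumption. apply HX; assumption.
      - rewrite RInt_const. unfold scal; simpl; unfold mult; simpl.
        assert (0 <= L * (M * (/ 2) ^ n))
          by (apply Rmult_le_pos; [lra | apply Rmult_le_pos; lra]).
        destruct Ht; nra. }
    assert (A2 := HX (S n) t Ht). rewrite <- (YX t Ht) in A2.
    assert (M * (/ 2) ^ S n <= M * (/ 2) ^ n)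
      by (apply Rmult_le_compat_l; [lra | simpl; lra]).
    apply Rabs_le_between in A1; apply Rabs_le_between in A2.
    apply Rabs_le_between; lra. }
  exists Z; split; [|split].
  - unfold Z; rewrite RInt_point; unfold zero; simpl; ring.
  - intros t; apply picard_step_continuous; exact cY.
  - intros t Ht; rewrite (ZY t Ht).
    replace (G t (Y t)) with (0 + G t (Y t)) by ring.
    apply (is_derive_plus (fun _ => y) (fun t => RInt (fun s => G s (Y s)) 0 t)).
    + apply (@is_derive_const R_AbsRing R_NormedModule).
    + apply (is_derive_RInt_continuous (fun s => G s (Y s))).
      intros s; apply G_cont; exact cY.
Qed.

End Picard.

(** * Truncated cubic and solutions on all of [[0,1]] *)

(** Freezing [x] outside [[-r, r]] and [t] outside [[0,1]] makes the right-hand side globally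
    Lipschitz in [x], as the Picard argument requires. *)
Definition abel_trunc (A B C : R -> R) (r t x : R) : R :=
  abel (ext01 A) (ext01 B) (ext01 C) t (clamp (- r) r x).

Lemma continuous_abel_trunc A B C r (X : R -> R) t :
  continuous01 A -> continuous01 B -> continuous01 C ->
  (forall t, continuous X t) -> continuous (fun s => abel_trunc A B C r s (X s)) t.
Proof.
  intros HA HB HC HX.
  assert (continuous (fun s => clamp (- r) r (X s)) t)
    by (apply continuous_comp; [apply HX | apply continuous_clamp]).
  unfold abel_trunc.
  apply (continuous_abel (ext01 A) (ext01 B) (ext01 C) (fun s => clamp (- r) r (X s)));
    [apply HA | apply HB | apply HC | assumption].
Qed.

Lemma bounded_ext01 g : continuous01 g ->
  exists M, 0 <= M /\ forall t, Rabs (ext01 g t) <= M.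
Proof.
  intros Hg; destruct (bounded01 (ext01 g) Hg) as [M [M0 HM]].
  exists M; split; [exact M0|]; intros t.
  assert (Ht : in01 (clamp 0 1 t)) by (apply clamp_in; lra).
  specialize (HM _ Ht). rewrite ext01_id in HM by exact Ht. exact HM.
Qed.

Lemma abel_quot_bound A B C r :
  continuous01 A -> continuous01 B -> continuous01 C -> 0 <= r ->
  exists L, 0 < L /\ forall t x y, Rabs x <= r -> Rabs y <= r ->
    Rabs (abel_quot (ext01 A) (ext01 B) (ext01 C) t x y) <= L.
Proof.
  intros HA HB HC Hr.
  destruct (bounded_ext01 A HA) as [MA [MA0 HMA]].
  destruct (bounded_ext01 B HB) as [MB [MB0 HMB]].
  destruct (bounded_ext01 C HC) as [MC [MC0 HMC]].
  (* In the box [|y^2 + y x + x^2| <= 3 r^2] and [|y + x| <= 2 r]; the summand 1 keeps [L]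
     positive. *)
  exists (MA * (3 * r ^ 2) + MB * (2 * r) + MC + 1); split.
  { assert (0 <= MA * (3 * r ^ 2)) by (apply Rmult_le_pos; nra).
    assert (0 <= MB * (2 * r)) by (apply Rmult_le_pos; nra). lra. }
  intros t x y Hx Hy; unfold abel_quot.
  apply Rabs_le_between in Hx; apply Rabs_le_between in Hy.
  assert (Rabs (ext01 A t * (y ^ 2 + y * x + x ^ 2)) <= MA * (3 * r ^ 2)).
  { rewrite Rabs_mult; apply Rmult_le_compat; try apply Rabs_pos; [apply HMA|].
    apply Rabs_le_between; nra. }
  assert (Rabs (ext01 B t * (y + x)) <= MB * (2 * r)).
  { rewrite Rabs_mult; apply Rmult_le_compat; try apply Rabs_pos; [apply HMB|].
    apply Rabs_le_between; lra. }
  eapply Rle_trans; [apply Rabs_triang|].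
  eapply Rle_trans; [apply Rplus_le_compat_r, Rabs_triang|].
  specialize (HMC t); lra.
Qed.

Lemma abel_trunc_lip A B C r :
  continuous01 A -> continuous01 B -> continuous01 C -> 0 <= r ->
  exists L, 0 < L /\ forall t x y,
    Rabs (abel_trunc A B C r t x - abel_trunc A B C r t y) <= L * Rabs (x - y).
Proof.
  intros HA HB HC Hr.
  destruct (abel_quot_bound A B C r HA HB HC Hr) as [L [L0 HL]].
  exists L; split; [exact L0|]; intros t x y.
  unfold abel_trunc. rewrite abel_quotE, Rabs_mult, Rmult_comm.
  assert (K : forall z, Rabs (clamp (- r) r z) <= r)
    by (intros z; apply Rabs_le_between, clamp_in; lra).
  apply Rmult_le_compat; try apply Rabs_pos; [apply HL; apply K | apply clamp_lip].
Qed.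

Lemma abel_trunc_id A B C r t x :
  in01 t -> Rabs x <= r -> abel_trunc A B C r t x = abel A B C t x.
Proof.
  intros Ht Hx; unfold abel_trunc, abel.
  rewrite !ext01_id by exact Ht. rewrite clamp_id; [reflexivity|].
  apply Rabs_le_between; exact Hx.
Qed.

Lemma gronwall (X Y dX dY : R -> R) L p q :
  p <= q -> 0 < L -> (forall t, continuous X t) -> (forall t, continuous Y t) ->
  (forall t, p < t < q -> is_derive X t (dX t)) ->
  (forall t, p < t < q -> is_derive Y t (dY t)) ->
  (forall t, p < t < q -> Rabs (dX t - dY t) <= L * Rabs (X t - Y t)) ->
  Rabs (X q - Y q) <= Rabs (X p - Y p) * exp (L * (q - p)).
Proof.
  intros pq L0 cX cY HX HY H.
  (* The square avoids differentiating an absolute value; the sign turns decay into the form of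
     [nondecreasing_of_deriv]. *)
  set (psi := fun t => - ((X t - Y t) * (X t - Y t) * exp (- (2 * L * t)))).
  assert (Hpsi : psi p <= psi q).
  { apply nondecreasing_of_deriv with (dg := fun t =>
      - ((2 * (X t - Y t) * (dX t - dY t) - 2 * L * (X t - Y t) * (X t - Y t))
        * exp (- (2 * L * t)))); [exact pq| | |].
    - intros t; unfold psi.
      apply (continuous_opp (fun t => (X t - Y t) * (X t - Y t) * exp (- (2 * L * t)))).
      apply continuous_Rmult; [apply continuous_Rmult; apply continuous_Rminus; auto|].
      apply (@ex_derive_continuous R_AbsRing R_NormedModule); auto_derive; auto.
    - intros t Ht; unfold psi.
      specialize (HX t Ht); specialize (HY t Ht).
      auto_derive.
      + repeat split; eexists; eassumption.
      + replace (Derive (fun x => X x) t) with (dX t)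
          by (symmetry; apply is_derive_unique; exact HX).
        replace (Derive (fun x => Y x) t) with (dY t)
          by (symmetry; apply is_derive_unique; exact HY).
        ring.
    - intros t Ht; specialize (H t Ht).
      set (e := X t - Y t) in *. set (de := dX t - dY t) in *.
      assert (E := exp_pos (- (2 * L * t))).
      assert (e * de <= L * (e * e)).
      { apply Rle_trans with (Rabs (e * de)); [apply Rle_abs|].
        rewrite Rabs_mult.
        replace (e * e) with (Rabs e * Rabs e)
          by (rewrite <- Rabs_mult; apply Rabs_pos_eq; nra).
        generalize (Rabs_pos e); nra. }
      assert (0 <= (2 * L * e * e - 2 * e * de)) by lra. nra. }
  unfold psi in Hpsi.
  assert (E : exp (- (2 * L * p)) = exp (- (2 * L * q)) * (exp (L * (q - p)) * exp (L * (q - p)))).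
  { rewrite <- !exp_plus; f_equal; ring. }
  rewrite E in Hpsi.
  assert (E1 := exp_pos (- (2 * L * q))). assert (E2 := exp_pos (L * (q - p))).
  set (k := exp (L * (q - p))) in *. set (j := exp (- (2 * L * q))) in *.
  rewrite <- (Rabs_pos_eq k) by lra. rewrite <- Rabs_mult.
  apply Rsqr_le_abs_0. unfold Rsqr. nra.
Qed.

(* [X] solves the equation truncated at [r], which is the original one as long as
   [|X| <= r]. *)
Lemma picard_near A B C r :
  continuous01 A -> continuous01 B -> continuous01 C -> 0 <= r ->
  exists L, 0 < L /\ forall y, exists X, X 0 = y /\ (forall t, continuous X t) /\
    ((forall t, in01 t -> Rabs (X t) <= r) -> sol (abel A B C) in01 X) /\
    forall u, sol (abel A B C) in01 u -> (forall t, in01 t -> Rabs (u t) <= r) ->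
      forall s t, 0 <= s <= t -> t <= 1 ->
        Rabs (X t - u t) <= Rabs (X s - u s) * exp (L * (t - s)).
Proof.
  intros HA HB HC Hr.
  destruct (abel_trunc_lip A B C r HA HB HC Hr) as [L [L0 HL]].
  exists L; split; [exact L0|]; intros y.
  destruct (picard_solution (abel_trunc A B C r) L y L0 HL) as [X [X0 [cX dX]]].
  { intros; apply continuous_abel_trunc; assumption. }
  exists X; split; [exact X0|split; [exact cX|split]].
  - intros HX; split; [apply is_interval_closed|split; [auto|]].
    intros t Ht; rewrite <- (abel_trunc_id A B C r) by auto.
    apply has_deriv_within_of_is_derive; auto.
  (* As [u] stays in the box it also solves the truncated equation, so the comparison holds even if
     [X] leaves the box. *)
  - intros u Hu Hru s t Hs Ht.
    rewrite <- (clamp_id 0 1 t) at 2 by lra. rewrite <- (clamp_id 0 1 s) at 2 by lra.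
    apply gronwall with (X := X) (Y := fun s => u (clamp 0 1 s))
      (dX := fun t => abel_trunc A B C r t (X t))
      (dY := fun t => abel A B C t (u t)); try lra.
    + exact cX.
    + intros; apply (sol_continuous (abel A B C)); [lra | exact Hu].
    + intros x Hx; apply dX; split; lra.
    + intros x Hx; apply (sol_is_derive (abel A B C)); [lra | exact Hu].
    + intros x Hx.
      assert (in01 x) by (split; lra).
      rewrite <- (abel_trunc_id A B C r) by auto.
      rewrite clamp_id by lra. apply HL.
Qed.

Lemma sol_bounded h u : sol h in01 u ->
  exists M, 0 <= M /\ forall t, in01 t -> Rabs (u t) <= M.
Proof.
  intros Hu.
  destruct (bounded01 (fun t => u (clamp 0 1 t))) as [M [M0 HM]].
  { intros; apply (sol_continuous h); [lra | exact Hu]. }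
  exists M; split; [exact M0|]; intros t Ht; specialize (HM t Ht).
  rewrite clamp_id in HM by exact Ht; exact HM.
Qed.

Lemma sol_exists_near A B C u :
  continuous01 A -> continuous01 B -> continuous01 C -> sol (abel A B C) in01 u ->
  exists del K, 0 < del /\ 0 < K /\ K * del <= 1 /\ forall y, Rabs (y - u 0) < del ->
    exists z, sol (abel A B C) in01 z /\ z 0 = y /\
      forall t, in01 t -> Rabs (z t - u t) <= K * Rabs (y - u 0).
Proof.
  intros HA HB HC Hu.
  destruct (sol_bounded _ u Hu) as [M [M0 HM]].
  (* The margin 1 over [M] is spent below: a start within [exp (- L)] of [u 0] stays within 1 of [u]
     up to time 1, hence inside the box. *)
  destruct (picard_near A B C (M + 1) HA HB HC ltac:(lra)) as [L [L0 HL]].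
  assert (KE : exp L * exp (- L) = 1) by (rewrite <- exp_plus, Rplus_opp_r; apply exp_0).
  exists (exp (- L)), (exp L).
  split; [apply exp_pos|split; [apply exp_pos|split; [right; exact KE|]]].
  intros y Hy; destruct (HL y) as [X [X0 [cX [HX HXu]]]].
  assert (near : forall t, in01 t -> Rabs (X t - u t) <= exp L * Rabs (y - u 0)).
  { intros t Ht; unfold in01 in Ht.
    specialize (HXu u Hu ltac:(intros s Hs; specialize (HM s Hs); lra) 0 t
                  ltac:(lra) ltac:(lra)).
    rewrite X0, Rminus_0_r, Rmult_comm in HXu.
    eapply Rle_trans; [exact HXu|]. apply Rmult_le_compat_r; [apply Rabs_pos|].
    destruct (Rle_lt_or_eq_dec t 1) as [l|E]; [lra| |].
    - left; apply exp_increasing; nra.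
    - rewrite E, Rmult_1_r; right; reflexivity. }
  exists X; split; [|split; [exact X0 | exact near]].
  apply HX; intros t Ht.
  assert (Rabs (X t - u t) <= 1).
  { eapply Rle_trans; [apply near; exact Ht|]. rewrite <- KE.
    apply Rmult_le_compat_l; [left; apply exp_pos | lra]. }
  replace (X t) with ((X t - u t) + u t) by ring.
  eapply Rle_trans; [apply Rabs_triang|]. specialize (HM t Ht); lra.
Qed.

Lemma IVT_continuous (g : R -> R) a b y :
  a <= b -> (forall t, continuous g t) -> g a <= y <= g b \/ g b <= y <= g a ->
  exists x, a <= x <= b /\ g x = y.
Proof.
  intros ab cg Hy.
  destruct (IVT_gen_consistent g a b y) as [x [Hx1 Hx2]].
  - exact cg.
  - unfold Rmin, Rmax; repeat destruct (Rle_dec _ _); lra.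
  - exists x; split; [|exact Hx2]. rewrite Rmin_left, Rmax_right in Hx1 by lra; exact Hx1.
Qed.

(** Two solutions defined on [[0,1]] are barriers: the solution of the truncated equation cannot
    cross them, so it stays where the truncation is inactive. *)
Lemma sol_exists_between A B C u v y :
  continuous01 A -> continuous01 B -> continuous01 C ->
  sol (abel A B C) in01 u -> sol (abel A B C) in01 v -> u 0 <= y <= v 0 ->
  exists z, sol (abel A B C) in01 z /\ z 0 = y.
Proof.
  intros HA HB HC Hu Hv Hy.
  destruct (sol_bounded _ u Hu) as [M [M0 HM]].
  destruct (sol_bounded _ v Hv) as [N [N0 HN]].
  destruct (picard_near A B C (Rmax M N) HA HB HC) as [L [L0 HL]].
  { apply Rle_trans with M; [lra | apply Rmax_l]. }
  destruct (HL y) as [X [X0 [cX [HX HXu]]]].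
  assert (HM' : forall t, in01 t -> Rabs (u t) <= Rmax M N)
    by (intros t Ht; eapply Rle_trans; [apply HM; exact Ht | apply Rmax_l]).
  assert (HN' : forall t, in01 t -> Rabs (v t) <= Rmax M N)
    by (intros t Ht; eapply Rle_trans; [apply HN; exact Ht | apply Rmax_r]).
  (* If [X] gets past [w], it meets [w] at some earlier time [s], and the Gronwall bound from [s],
     starting at 0, makes them equal at [t]. *)
  assert (meet : forall w t, sol (abel A B C) in01 w ->
     (forall t, in01 t -> Rabs (w t) <= Rmax M N) -> in01 t ->
     w 0 <= y /\ X t <= w t \/ y <= w 0 /\ w t <= X t -> X t = w t).
  { intros w t Hw Hwb Ht D. assert (Ht' := Ht); unfold in01 in Ht'.
    destruct (IVT_continuous (fun s => X s - w (clamp 0 1 s)) 0 t 0) as [s [Hs1 Hs2]].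
    - lra.
    - intros s; apply continuous_Rminus; [apply cX|].
      apply (sol_continuous (abel A B C)); [lra | exact Hw].
    - rewrite !clamp_id by lra. rewrite X0; lra.
    - rewrite clamp_id in Hs2 by lra.
      specialize (HXu w Hw Hwb s t ltac:(lra) ltac:(lra)).
      rewrite Hs2, Rabs_R0, Rmult_0_l in HXu.
      apply Rminus_diag_uniq; destruct (Req_dec (X t - w t) 0) as [E|E]; [exact E|].
      apply Rabs_pos_lt in E; lra. }
  exists X; split; [|exact X0]. apply HX; intros t Ht.
  assert (Lo : u t <= X t).
  { destruct (Rle_dec (u t) (X t)) as [l|l]; [exact l|].
    rewrite (meet u t Hu HM' Ht); lra. }
  assert (Hi : X t <= v t).
  { destruct (Rle_dec (X t) (v t)) as [l|l]; [exact l|].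
    rewrite (meet v t Hv HN' Ht); lra. }
  specialize (HM' t Ht); specialize (HN' t Ht).
  apply Rabs_le_between in HM'; apply Rabs_le_between in HN'.
  apply Rabs_le_between; lra.
Qed.

(** * The function [f] along solutions *)

Lemma dx_abel A B C t x : dx (abel A B C) t x = abel_quot A B C t x x.
Proof.
  unfold dx, abel, abel_quot. apply is_derive_unique. auto_derive; [auto|ring].
Qed.

Lemma C1_2d_differentiable f t x : C1_2d f -> differentiable_pt_lim f t x (dt f t x) (dx f t x).
Proof.
  intros Hf; apply filterdiff_differentiable_pt_lim.
  apply (is_derive_filterdiff f t x (dt f) (dx f t x)).
  - apply filter_forall; intros [s y]; simpl.
    apply Derive_correct, (Hf s y).
  - apply Derive_correct, (Hf t x).
  - apply (Hf t x).
Qed.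

Lemma C1_2d_continuous f (t x : R) : C1_2d f ->
  continuous (fun p : R * R => f (fst p) (snd p)) (t, x).
Proof.
  intros Hf.
  assert (H : continuity_2d_pt f t x).
  { apply differentiable_continuity_pt. exists (dt f t x), (dx f t x).
    apply C1_2d_differentiable; exact Hf. }
  apply continuity_2d_pt_filterlim in H; exact H.
Qed.

Lemma C1_2d_continuous_comp f (a b : R -> R) t : C1_2d f ->
  continuous a t -> continuous b t -> continuous (fun s => f (a s) (b s)) t.
Proof. intros; apply continuous_comp_2; auto using C1_2d_continuous. Qed.

Lemma is_derive_along f h u t :
  C1_2d f -> 0 < t < 1 -> sol h in01 u ->
  is_derive (fun s => f (clamp 0 1 s) (u (clamp 0 1 s))) t
    (dt f t (u t) + dx f t (u t) * h t (u t)).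
Proof.
  intros Hf Ht Hu.
  apply is_derive_ext_loc with (fun s => f s (u (clamp 0 1 s))).
  { exists (mkposreal (Rmin t (1 - t)) ltac:(apply Rmin_pos; lra)); simpl.
    intros s Hs. unfold ball in Hs; simpl in Hs; unfold AbsRing_ball in Hs.
    unfold abs, minus, plus, opp in Hs; simpl in Hs.
    apply Rabs_lt_between in Hs.
    assert (K1 := Rmin_l t (1 - t)). assert (K2 := Rmin_r t (1 - t)).
    rewrite clamp_id by lra; reflexivity. }
  apply is_derive_Reals.
  replace (dt f t (u t) + dx f t (u t) * h t (u t))
    with (dt f t (u t) * 1 + dx f t (u t) * h t (u t)) by ring.
  apply (derivable_pt_lim_comp_2d f (fun s => s) (fun s => u (clamp 0 1 s))).
  - rewrite clamp_id by lra. apply C1_2d_differentiable; exact Hf.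
  - apply derivable_pt_lim_id.
  - apply is_derive_Reals, sol_is_derive; [exact Ht | exact Hu].
Qed.

Lemma zero_on_closure (g : R -> R) :
  (forall t, continuous g t) -> (forall t, 0 < t < 1 -> g t = 0) ->
  forall t, in01 t -> g t = 0.
Proof.
  intros cg H t Ht.
  destruct (Req_dec (g t) 0) as [E|E]; [exact E|exfalso].
  destruct (proj1 (continuous_eps g t) (cg t) (Rabs (g t)) (Rabs_pos_lt _ E))
    as [d [d0 Hd]].
  (* Moving [t] slightly towards [1 / 2] reaches the open interval, even if [t] is 0 or 1. *)
  set (s := (1 - Rmin (1 / 2) d) * t + Rmin (1 / 2) d * (1 / 2)).
  assert (K0 : 0 < Rmin (1 / 2) d) by (apply Rmin_pos; lra).
  assert (K1 := Rmin_l (1 / 2) d). assert (K2 := Rmin_r (1 / 2) d).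
  set (m := Rmin _ _) in *. destruct Ht as [t0 t1].
  assert (Hs : 0 < s < 1) by (unfold s; split; nra).
  specialize (Hd s). rewrite (H s Hs), Rminus_0_l, Rabs_Ropp in Hd.
  apply (Rlt_irrefl (Rabs (g t))), Hd. unfold s.
  replace ((1 - m) * t + m * (1 / 2) - t) with (m * (1 / 2 - t)) by ring.
  apply Rabs_def1; nra.
Qed.

(** * Derivative of the Poincaré map *)

(** On the diagonal [abel_quot] is [dh/dx], so this is [div(1,h)] along [u], extended continuously
    to all times. *)
Definition slope (A B C u : R -> R) (t : R) : R :=
  abel_quot (ext01 A) (ext01 B) (ext01 C) t (ext01 u t) (ext01 u t).

Lemma slopeE A B C u t : in01 t -> slope A B C u t = dx (abel A B C) t (u t).
Proof.
  intros Ht; rewrite dx_abel; unfold slope, abel_quot.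
  rewrite !ext01_id by exact Ht; reflexivity.
Qed.

Lemma continuous_slope A B C u t :
  continuous01 A -> continuous01 B -> continuous01 C -> continuous01 u ->
  continuous (slope A B C u) t.
Proof. intros; apply continuous_abel_quot; auto. Qed.

Lemma sol_continuous01 h u : sol h in01 u -> continuous01 u.
Proof. intros Hu t; apply (sol_continuous h); [lra | exact Hu]. Qed.

(** By [sol_diff] the difference quotient of the Poincaré map is exactly [exp k], and [k] tends to
    the integral of the tangent slope because the neighbouring solution tends uniformly to [u]. *)
Lemma poincare_deriv_exp A B C u :
  continuous01 A -> continuous01 B -> continuous01 C -> sol (abel A B C) in01 u ->
  poincare_deriv (abel A B C) (u 0) (exp (RInt (slope A B C u) 0 1)).
Proof.
  intros HA HB HC Hu.
  assert (I0 : in01 0) by (split; lra). assert (I1 : in01 1) by (split; lra).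
  destruct (sol_exists_near A B C u HA HB HC Hu) as [d [K [d0 [K0 [Kd near]]]]].
  split.
  { exists d; split; [exact d0|]; intros y Hy.
    destruct (near y Hy) as [z [Hz [z0 _]]]; exists (z 1), z; auto. }
  destruct (sol_bounded _ u Hu) as [M [M0 HM]].
  destruct (bounded_ext01 A HA) as [MA [MA0 HMA]].
  destruct (bounded_ext01 B HB) as [MB [MB0 HMB]].
  set (Q := RInt (slope A B C u) 0 1). intros eps He.
  destruct (proj1 (continuous_eps exp Q) (continuous_exp Q) eps He) as [e [e0 Hexp]].
  (* The secant and tangent slopes differ by [(A ((v - u) + 3 u) + B) (v - u)], where
     [|v - u| <= K |y - u 0| <= 1]. The summand 1 keeps [N] positive. *)
  set (N := (MA * (1 + 3 * M) + MB) * K + 1).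
  assert (N0 : 0 < N).
  { unfold N; assert (0 <= MA * (1 + 3 * M)) by (apply Rmult_le_pos; lra).
    assert (0 <= (MA * (1 + 3 * M) + MB) * K) by (apply Rmult_le_pos; lra). lra. }
  exists (Rmin d (e / N)); split.
  { apply Rmin_pos; [exact d0 | apply Rdiv_lt_0_compat; lra]. }
  intros y z z0 [Hy0 Hy] [u' [Hu' [u'0 u'1]]] [v [Hv [v0 v1]]].
  rewrite (sol_unique_at A B C in01 u u' 0 1) in u'1 by assumption.
  assert (Hyd : Rabs (y - u 0) < d) by (generalize (Rmin_l d (e / N)); lra).
  assert (Hye : Rabs (y - u 0) < e / N) by (generalize (Rmin_r d (e / N)); lra).
  destruct (near y Hyd) as [v' [Hv' [v'0 Hnear]]].
  assert (vv : forall t, in01 t -> v t = v' t).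
  { intros t Ht; apply (sol_unique_at A B C in01 v' v 0 t); auto; congruence. }
  destruct (sol_diff A B C 0 1 u v) as [k [Hk kQ]]; try lra; try assumption.
  rewrite v0, v1, u'1 in Hk. rewrite Hk.
  assert (y <> u 0) by (intros E; rewrite E, Rminus_diag, Rabs_R0 in Hy0; lra).
  replace ((y - u 0) * exp k / (y - u 0)) with (exp k) by (field; lra).
  apply Hexp.
  set (dl := Rabs (y - u 0)) in *.
  apply Rle_lt_trans with ((1 - 0) * ((MA * (1 + 3 * M) + MB) * (K * dl))).
  - apply kQ.
    { intros; apply continuous_slope; auto; apply (sol_continuous01 _ _ Hu). }
    intros t Ht. fold (in01 t) in Ht.
    specialize (Hnear t Ht). rewrite <- (vv t Ht) in Hnear.
    specialize (HM t Ht). specialize (HMA t). specialize (HMB t).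
    rewrite ext01_id in HMA, HMB by exact Ht.
    rewrite slopeE, dx_abel by exact Ht.
    replace (abel_quot A B C t (u t) (v t) - abel_quot A B C t (u t) (u t)) with
      ((A t * ((v t - u t) + 3 * u t) + B t) * (v t - u t)) by (unfold abel_quot; ring).
    rewrite Rabs_mult; apply Rmult_le_compat; try apply Rabs_pos; [|exact Hnear].
    eapply Rle_trans; [apply Rabs_triang|]. apply Rplus_le_compat; [|exact HMB].
    rewrite Rabs_mult; apply Rmult_le_compat; try apply Rabs_pos; [exact HMA|].
    eapply Rle_trans; [apply Rabs_triang|]. apply Rplus_le_compat.
    + eapply Rle_trans; [exact Hnear|].
      assert (K * dl <= K * d) by (apply Rmult_le_compat_l; lra). lra.
    + rewrite Rabs_mult, (Rabs_pos_eq 3) by lra; lra.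
  - apply Rlt_le_trans with (N * (e / N)); [|right; field; lra].
    apply Rle_lt_trans with (N * dl); [unfold N; lra|].
    apply Rmult_lt_compat_l; assumption.
Qed.

Definition graph (u : R -> R) (p : R * R) : Prop := in01 (fst p) /\ snd p = u (fst p).

Lemma graph_invariant A B C u :
  continuous01 A -> continuous01 B -> continuous01 C -> sol (abel A B C) in01 u ->
  invariant (abel A B C) (graph u).
Proof.
  intros HA HB HC Hu; split; [intros p [H _]; exact H|].
  intros I x Hx t0 t1 I0 I1 [_ E]; simpl in E.
  split; simpl; [apply Hx; exact I1|].
  apply (sol_unique_at A B C I u x t0 t1); auto.
  apply sol_subset with in01; auto; [apply Hx | apply Hx].
Qed.

(** * Sign of [f] along a solution, and stability of periodic orbits *)

Section AlongSolutions.

Context (A B C : R -> R) (f : R -> R -> R) (w : R).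
Context (HA : continuous01 A) (HB : continuous01 B) (HC : continuous01 C)
  (Hf : C1_2d f) (Hper : periodic1 f)
  (M_nneg : forall t x, in01 t -> 0 <= Mw (abel A B C) f w t x)
  (M_zeros : forall P, invariant (abel A B C) P ->
     (forall p, P p -> Mw (abel A B C) f w (fst p) (snd p) = 0) ->
     forall p, P p -> f (fst p) (snd p) = 0).

Definition weight (u : R -> R) (t : R) : R := exp (w * RInt (slope A B C u) 0 t).

Definition weighted (u : R -> R) (t : R) : R :=
  f (clamp 0 1 t) (u (clamp 0 1 t)) * weight u t.

Lemma weighted_continuous u t : sol (abel A B C) in01 u -> continuous (weighted u) t.
Proof.
  intros Hu; apply continuous_Rmult.
  - apply C1_2d_continuous_comp; [exact Hf | apply continuous_clamp|].
    apply (sol_continuous01 _ _ Hu).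
  - apply continuous_exp_comp, continuous_Rmult; [apply continuous_const|].
    apply continuous_RInt_upper; intros; apply continuous_slope; auto.
    apply (sol_continuous01 _ _ Hu).
Qed.

Lemma weighted_is_derive u t : sol (abel A B C) in01 u -> 0 < t < 1 ->
  is_derive (weighted u) t (Mw (abel A B C) f w t (u t) * weight u t).
Proof.
  intros Hu Ht.
  assert (It : in01 t) by (split; lra).
  assert (d1 := is_derive_along f (abel A B C) u t Hf Ht Hu).
  assert (d2 : is_derive (weight u) t (w * slope A B C u t * weight u t)).
  { apply (is_derive_comp exp (fun t => w * RInt (slope A B C u) 0 t)).
    - apply is_derive_exp.
    - apply is_derive_scal, is_derive_RInt_continuous.
      intros; apply continuous_slope; auto; apply (sol_continuous01 _ _ Hu). }
  assert (d := is_derive_mult _ _ t _ _ d1 d2 Rmult_comm).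
  replace (Mw (abel A B C) f w t (u t) * weight u t) with
    (plus (mult (dt f t (u t) + dx f t (u t) * abel A B C t (u t)) (weight u t))
       (mult (f (clamp 0 1 t) (u (clamp 0 1 t))) (w * slope A B C u t * weight u t))).
  { exact d. }
  unfold plus, mult; simpl. rewrite clamp_id by exact It.
  rewrite slopeE by exact It. unfold Mw; ring.
Qed.

Lemma weighted_nondecreasing u s t : sol (abel A B C) in01 u ->
  0 <= s <= t -> t <= 1 -> weighted u s <= weighted u t.
Proof.
  intros Hu Hs Ht.
  apply nondecreasing_of_deriv with
    (dg := fun t => Mw (abel A B C) f w t (u t) * weight u t); [lra| | |].
  - intros; apply weighted_continuous; exact Hu.
  - intros; apply weighted_is_derive; [exact Hu | lra].
  - intros x Hx; apply Rmult_le_pos; [apply M_nneg; split; lra | left; apply exp_pos].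
Qed.

Lemma weightedE u t : in01 t -> weighted u t = f t (u t) * weight u t.
Proof. intros Ht; unfold weighted; rewrite clamp_id by exact Ht; reflexivity. Qed.

Lemma weight_pos u t : 0 < weight u t.
Proof. apply exp_pos. Qed.

Lemma f_nneg_forward u s t : sol (abel A B C) in01 u -> 0 <= s <= t -> t <= 1 ->
  0 <= f s (u s) -> 0 <= f t (u t).
Proof.
  intros Hu Hs Ht H.
  assert (K := weighted_nondecreasing u s t Hu Hs Ht).
  rewrite !weightedE in K by (split; lra).
  generalize (weight_pos u s) (weight_pos u t); nra.
Qed.

Lemma f_pos_forward u s t : sol (abel A B C) in01 u -> 0 <= s <= t -> t <= 1 ->
  0 < f s (u s) -> 0 < f t (u t).
Proof.
  intros Hu Hs Ht H.
  assert (K := weighted_nondecreasing u s t Hu Hs Ht).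
  rewrite !weightedE in K by (split; lra).
  generalize (weight_pos u s) (weight_pos u t); nra.
Qed.

(** A monotone function with equal end values is constant, so its derivative, [M_w] times a positive
    weight, vanishes on the open interval; continuity adds the ends. *)
Lemma Mw_zero_of_weighted u : sol (abel A B C) in01 u -> weighted u 0 = weighted u 1 ->
  forall t, in01 t -> Mw (abel A B C) f w t (u t) = 0.
Proof.
  intros Hu E.
  (* [M_w] along [u], extended to a function continuous on the whole line for [zero_on_closure]. *)
  set (g := fun t => dt f (clamp 0 1 t) (ext01 u t)
     + dx f (clamp 0 1 t) (ext01 u t)
       * abel (ext01 A) (ext01 B) (ext01 C) t (ext01 u t)
     + w * f (clamp 0 1 t) (ext01 u t) * slope A B C u t).
  assert (gE : forall t, in01 t -> g t = Mw (abel A B C) f w t (u t)).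
  { intros t Ht; unfold g, Mw. rewrite slopeE by exact Ht.
    unfold abel at 1. rewrite !ext01_id, clamp_id by exact Ht. unfold abel at 2; ring. }
  assert (cu : continuous01 u) by (apply (sol_continuous01 _ _ Hu)).
  intros t Ht; rewrite <- gE by exact Ht; revert t Ht.
  apply zero_on_closure.
  - intros t.
    assert (cf1 : continuous (fun s => dt f (clamp 0 1 s) (ext01 u s)) t).
    { apply (continuous_comp_2 (clamp 0 1) (ext01 u) (dt f));
        [apply continuous_clamp | apply cu | apply (Hf (clamp 0 1 t) (ext01 u t))]. }
    assert (cf2 : continuous (fun s => dx f (clamp 0 1 s) (ext01 u s)) t).
    { apply (continuous_comp_2 (clamp 0 1) (ext01 u) (dx f));
        [apply continuous_clamp | apply cu | apply (Hf (clamp 0 1 t) (ext01 u t))]. }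
    assert (cf3 : continuous (fun s => f (clamp 0 1 s) (ext01 u s)) t).
    { apply C1_2d_continuous_comp; [exact Hf | apply continuous_clamp | apply cu]. }
    assert (cs : continuous (slope A B C u) t) by (apply continuous_slope; assumption).
    assert (ca : continuous
      (fun s => abel (ext01 A) (ext01 B) (ext01 C) s (ext01 u s)) t).
    { apply continuous_abel; [apply HA | apply HB | apply HC | apply cu]. }
    apply continuous_Rplus;
      [apply continuous_Rplus; [exact cf1 | apply continuous_Rmult; assumption]|].
    apply continuous_Rmult; [|exact cs].
    apply continuous_Rmult; [apply continuous_const | exact cf3].
  - intros t Ht; rewrite gE by (split; lra).
    assert (d0 : is_derive (weighted u) t 0).
    { apply is_derive_ext_loc with (fun _ => weighted u 0).
      - exists (mkposreal (Rmin t (1 - t)) ltac:(apply Rmin_pos; lra)); simpl.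
        intros s Hs. unfold ball in Hs; simpl in Hs; unfold AbsRing_ball in Hs.
        unfold abs, minus, plus, opp in Hs; simpl in Hs.
        apply Rabs_lt_between in Hs.
        assert (K1 := Rmin_l t (1 - t)). assert (K2 := Rmin_r t (1 - t)).
        apply Rle_antisym; [|rewrite E];
          apply weighted_nondecreasing; try exact Hu; lra.
      - apply (@is_derive_const R_AbsRing R_NormedModule). }
    assert (d1 := weighted_is_derive u t Hu Ht).
    apply is_derive_unique in d0; apply is_derive_unique in d1.
    rewrite d0 in d1. symmetry in d1; apply Rmult_integral in d1.
    generalize (weight_pos u t); destruct d1; lra.
Qed.

(** Equality would make [graph u] an invariant set of zeros of [M_w], and [M_zeros] would place it
    in [{f = 0}]. *)
Lemma weighted_lt u : sol (abel A B C) in01 u ->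
  (exists t, in01 t /\ f t (u t) <> 0) -> weighted u 0 < weighted u 1.
Proof.
  intros Hu [t [Ht H]].
  destruct (Rle_lt_or_eq_dec (weighted u 0) (weighted u 1)) as [K|K]; [|exact K|].
  - apply weighted_nondecreasing; [exact Hu | lra | lra].
  - exfalso; apply H.
    apply (M_zeros (graph u) (graph_invariant A B C u HA HB HC Hu)) with (p := (t, u t)).
    + intros [s x] [Hs Ex]; simpl in *; subst x.
      apply (Mw_zero_of_weighted u Hu K s Hs).
    + split; [exact Ht | reflexivity].
Qed.

Lemma f_time_periodic x : f 1 x = f 0 x.
Proof. rewrite <- (Hper 0 x); f_equal; ring. Qed.

Lemma weighted_0 u : weighted u 0 = f 0 (u 0).
Proof.
  rewrite weightedE by (split; lra). unfold weight.
  rewrite RInt_point; unfold zero; simpl. rewrite Rmult_0_r, exp_0; ring.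
Qed.

Lemma f_zero_between u : sol (abel A B C) in01 u -> f 0 (u 0) = 0 -> f 1 (u 1) = 0 ->
  forall t, in01 t -> f t (u t) = 0.
Proof.
  intros Hu E0 E1 t [t0 t1]; apply Rle_antisym.
  - apply Rnot_lt_le; intros H.
    assert (0 < f 1 (u 1)) by (apply (f_pos_forward u t 1); try assumption; lra). lra.
  - apply (f_nneg_forward u 0 t); try assumption; lra.
Qed.

Lemma periodic_f_sign u : sol (abel A B C) in01 u -> u 0 = u 1 ->
  forall t, in01 t ->
    (f 0 (u 0) = 0 -> f t (u t) = 0) /\
    (0 < f 0 (u 0) -> 0 < f t (u t)) /\ (f 0 (u 0) < 0 -> f t (u t) < 0).
Proof.
  intros Hu E t Ht.
  assert (F1 : f 1 (u 1) = f 0 (u 0)) by (rewrite f_time_periodic, E; reflexivity).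
  split; [|split].
  - intros H; apply f_zero_between; try assumption; lra.
  - intros H; apply (f_pos_forward u 0 t); try assumption; destruct Ht; lra.
  - intros H; apply Rnot_le_lt; intros K.
    assert (0 <= f 1 (u 1))
      by (apply (f_nneg_forward u t 1); try assumption; destruct Ht; lra). lra.
Qed.

Lemma periodic_nonzero u : sol (abel A B C) in01 u -> u 0 = u 1 ->
  (exists t, in01 t /\ f t (u t) <> 0) ->
  f 0 (u 0) <> 0 /\ 0 < f 0 (u 0) * (w * RInt (slope A B C u) 0 1).
Proof.
  intros Hu E Hne.
  assert (K := weighted_lt u Hu Hne).
  rewrite weighted_0, weightedE, f_time_periodic, <- E in K by (split; lra).
  unfold weight in K. set (q := w * _) in *.
  assert (f 0 (u 0) <> 0) by (intros Z; rewrite Z in K; lra).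
  split; [assumption|].
  assert (E0 := exp_0).
  destruct (Rlt_le_dec q 0) as [Q|[Q|Q]].
  - assert (exp q < exp 0) by (apply exp_increasing; exact Q). nra.
  - assert (exp 0 < exp q) by (apply exp_increasing; exact Q). nra.
  - rewrite <- Q, exp_0 in K; lra.
Qed.

Lemma exists_Mw_pos u : sol (abel A B C) in01 u ->
  (exists t, in01 t /\ f t (u t) <> 0) ->
  exists t, in01 t /\ 0 < Mw (abel A B C) f w t (u t).
Proof.
  intros Hu [t [Ht H]]. apply NNPP; intros N; apply H.
  apply (M_zeros (graph u) (graph_invariant A B C u HA HB HC Hu)) with (p := (t, u t));
    [|split; [exact Ht | reflexivity]].
  intros [s x] [Hs Ex]; simpl in *; subst x.
  apply Rle_antisym; [|apply M_nneg; exact Hs].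
  apply Rnot_lt_le; intros P; apply N; exists s; auto.
Qed.

Lemma periodic_orbit_stability u : sol (abel A B C) in01 u -> u 0 = u 1 ->
  (exists t, in01 t /\ f t (u t) <> 0) ->
  (forall t, in01 t -> f t (u t) <> 0) /\
  hyperbolic (abel A B C) (u 0) /\
  ((exists d, poincare_deriv (abel A B C) (u 0) d /\ d < 1) /\
      (forall t, in01 t -> w * f t (u t) * Mw (abel A B C) f w t (u t) <= 0) /\
      (exists t, in01 t /\ w * f t (u t) * Mw (abel A B C) f w t (u t) < 0)
    \/
    (exists d, poincare_deriv (abel A B C) (u 0) d /\ 1 < d) /\
      (forall t, in01 t -> 0 <= w * f t (u t) * Mw (abel A B C) f w t (u t)) /\
      (exists t, in01 t /\ 0 < w * f t (u t) * Mw (abel A B C) f w t (u t))).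
Proof.
  intros Hu E Hne.
  destruct (periodic_nonzero u Hu E Hne) as [F0 FQ].
  (* [M_w] may vanish at some times of the orbit; [tm] is a time at which the sign is strict. *)
  destruct (exists_Mw_pos u Hu Hne) as [tm [Htm Hm]].
  assert (D := poincare_deriv_exp A B C u HA HB HC Hu).
  set (q := RInt (slope A B C u) 0 1) in *.
  assert (sgn : forall t, in01 t -> 0 < f 0 (u 0) * f t (u t)).
  { intros t Ht; destruct (periodic_f_sign u Hu E t Ht) as [_ [P N]].
    destruct (Rdichotomy _ _ F0) as [L|L]; [specialize (N L) | specialize (P L)]; nra. }
  (* Multiplying [sgn] by [FQ] gives this up to the positive factor [f 0 (u 0)] squared. So [w f]
     has the sign of [q], the logarithm of the Poincaré derivative. *)
  assert (wsgn : forall t, in01 t -> 0 < (w * f t (u t)) * q).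
  { intros t Ht; specialize (sgn t Ht).
    replace (f 0 (u 0) * (w * q)) with (f 0 (u 0) * (w * q)) in FQ by ring.
    assert (P : 0 < (f 0 (u 0) * f t (u t)) * (f 0 (u 0) * (w * q)))
      by (apply Rmult_lt_0_compat; assumption).
    assert (0 < f 0 (u 0) * f 0 (u 0)) by nra.
    apply Rmult_lt_reg_l with (f 0 (u 0) * f 0 (u 0)); [assumption|]. nra. }
  assert (q0 : q <> 0) by (intros Z; rewrite Z in FQ; lra).
  assert (E0 := exp_0).
  split; [|split].
  - intros t Ht Z; specialize (sgn t Ht); rewrite Z in sgn; lra.
  - exists (exp q); split; [exact D|].
    destruct (Rdichotomy _ _ q0) as [L|L]; apply exp_increasing in L; lra.
  - destruct (Rdichotomy _ _ q0) as [L|L]; [left|right]; (split; [|split]).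
    + exists (exp q); split; [exact D|]. apply exp_increasing in L; lra.
    + intros t Ht; specialize (wsgn t Ht); specialize (M_nneg t (u t) Ht).
      assert (w * f t (u t) < 0) by nra. nra.
    + exists tm; split; [exact Htm|]. specialize (wsgn tm Htm).
      assert (w * f tm (u tm) < 0) by nra. nra.
    + exists (exp q); split; [exact D|]. apply exp_increasing in L; lra.
    + intros t Ht; specialize (wsgn t Ht); specialize (M_nneg t (u t) Ht).
      assert (0 < w * f t (u t)) by nra. nra.
    + exists tm; split; [exact Htm|]. specialize (wsgn tm Htm).
      assert (0 < w * f tm (u tm)) by nra. nra.
Qed.

End AlongSolutions.

(** * Connected sets *)

Lemma open_prod_eps (U : R * R -> Prop) t x : open U -> U (t, x) ->
  exists d, 0 < d /\ forall s y, Rabs (s - t) < d -> Rabs (y - x) < d -> U (s, y).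
Proof.
  intros HU H; destruct (HU _ H) as [d Hd]; exists d; split; [apply cond_pos|].
  intros s y Hs Hy; apply Hd; split; assumption.
Qed.

Lemma open_slice_fst (U : R * R -> Prop) x : open U -> open (fun t : R => U (t, x)).
Proof.
  intros HU t H; destruct (open_prod_eps U t x HU H) as [d [d0 Hd]].
  exists (mkposreal d d0); intros s Hs; apply Hd; [exact Hs|].
  rewrite Rminus_diag, Rabs_R0; exact d0.
Qed.

(** Openness is relative to [[a, b]], since [band_connected] applies this to sets of parameters that
    are open only within their segment. *)
Lemma interval_connected (P Q : R -> Prop) a b :
  (forall t, a <= t <= b -> P t -> exists d, 0 < d /\
     forall s, a <= s <= b -> Rabs (s - t) < d -> P s) ->
  (forall t, a <= t <= b -> Q t -> exists d, 0 < d /\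
     forall s, a <= s <= b -> Rabs (s - t) < d -> Q s) ->
  (forall t, a <= t <= b -> P t \/ Q t) ->
  (exists t, a <= t <= b /\ P t) -> (exists t, a <= t <= b /\ Q t) ->
  exists t, a <= t <= b /\ P t /\ Q t.
Proof.
  assert (ordered : forall P Q : R -> Prop,
    (forall t, a <= t <= b -> P t -> exists d, 0 < d /\
       forall s, a <= s <= b -> Rabs (s - t) < d -> P s) ->
    (forall t, a <= t <= b -> Q t -> exists d, 0 < d /\
       forall s, a <= s <= b -> Rabs (s - t) < d -> Q s) ->
    (forall t, a <= t <= b -> P t \/ Q t) ->
    forall x y, a <= x <= y -> y <= b -> P x -> Q y ->
    exists t, a <= t <= b /\ P t /\ Q t).
  { clear P Q; intros P Q oP oQ PQ x y xy yb Px Qy.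
    (* The supremum [s] of [P] below [y]: if [P s], openness forces [s = y], where [Q] holds as
       well; if [Q s], points of [P] just below [s] are in [Q]. *)
    destruct (completeness (fun t => x <= t <= y /\ P t)) as [s [Hs1 Hs2]].
    { exists y; intros t Ht; apply Ht. }
    { exists x; split; [lra | exact Px]. }
    assert (xs : x <= s) by (apply Hs1; split; [lra | exact Px]).
    assert (sy : s <= y) by (apply Hs2; intros t Ht; apply Ht).
    destruct (classic (P s)) as [Ps|nPs].
    - destruct (oP s ltac:(lra) Ps) as [d [d0 Hd]].
      destruct (Rle_lt_or_eq_dec s y sy) as [l|E].
      + exfalso. assert (m0 : 0 < Rmin (d / 2) (y - s)) by (apply Rmin_pos; lra).
        assert (m1 := Rmin_l (d / 2) (y - s)). assert (m2 := Rmin_r (d / 2) (y - s)).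
        set (m := Rmin _ _) in *.
        assert (s + m <= s); [|lra].
        apply Hs1; split; [lra|]. apply Hd; [lra|]. apply Rabs_def1; lra.
      + exists s; rewrite E in *; repeat split; try assumption; lra.
    - destruct (PQ s ltac:(lra)) as [|Qs]; [contradiction|].
      destruct (oQ s ltac:(lra) Qs) as [d [d0 Hd]].
      destruct (classic (exists t, (x <= t <= y /\ P t) /\ s - d < t)) as [[t [[Ht Pt] Hst]]|N].
      + exists t; split; [lra|]. split; [exact Pt|]. apply Hd; [lra|].
        assert (t <= s) by (apply Hs1; split; assumption). apply Rabs_def1; lra.
      + exfalso. assert (s <= s - d); [|lra].
        apply Hs2; intros t Ht. apply Rnot_lt_le; intros K; apply N; exists t; auto. }
  intros oP oQ PQ [x [Hx Px]] [y [Hy Qy]].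
  destruct (Rle_dec x y) as [l|l].
  - apply (ordered P Q oP oQ PQ x y); auto; lra.
  - destruct (ordered Q P oQ oP) with (x := y) (y := x) as [t [Ht [H1 H2]]]; auto; try lra.
    + intros t Ht; destruct (PQ t Ht); auto.
    + exists t; auto.
Qed.

Lemma open_relative (P : R -> Prop) a b t : open P -> P t ->
  exists d, 0 < d /\ forall s, a <= s <= b -> Rabs (s - t) < d -> P s.
Proof.
  intros oP Pt; destruct (oP t Pt) as [d Hd]; exists d; split; [apply cond_pos|].
  intros s _ Hs; apply Hd; exact Hs.
Qed.

Lemma segment_image_connected a b (c : R -> R * R) :
  (forall t, continuous c t) ->
  connected2 (fun p => exists t, a <= t <= b /\ p = c t).
Proof.
  intros cc U V oU oV cov [p [[t [Ht Ep]] Up]] [q [[s [Hs Eq]] Vq]]; subst p q.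
  destruct (interval_connected (fun t => U (c t)) (fun t => V (c t)) a b)
    as [x [Hx [Ux Vx]]].
  - intros x _ Hx; apply (open_relative (fun t => U (c t))); [|exact Hx].
    apply (open_comp c U); [intros; apply cc | exact oU].
  - intros x _ Hx; apply (open_relative (fun t => V (c t))); [|exact Hx].
    apply (open_comp c V); [intros; apply cc | exact oV].
  - intros x Hx; apply cov; exists x; auto.
  - exists t; auto.
  - exists s; auto.
  - exists (c x); split; [exists x; auto | auto].
Qed.

Lemma connected2_image (K : R * R -> Prop) (c : R * R -> R * R) :
  (forall p, continuous c p) -> connected2 K ->
  connected2 (fun q => exists p, K p /\ q = c p).
Proof.
  intros cc HK U V oU oV cov [p [[t [Ht Ep]] Up]] [q [[s [Hs Eq]] Vq]]; subst p q.
  destruct (HK (fun p => U (c p)) (fun p => V (c p))) as [x [Hx [Ux Vx]]].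
  - apply (open_comp c U); [intros; apply cc | exact oU].
  - apply (open_comp c V); [intros; apply cc | exact oV].
  - intros p Hp; apply cov; exists p; auto.
  - exists t; auto.
  - exists s; auto.
  - exists (c x); split; [exists x; auto | auto].
Qed.

Lemma continuous_pair (T : UniformSpace) (g k : T -> R) (p : T) :
  continuous g p -> continuous k p -> continuous (fun q => (g q, k q)) p.
Proof.
  intros Hg Hk.
  apply (continuous_comp_2 g k (fun a b => (a, b)) p Hg Hk).
  apply continuous_ext with (fun q : R * R => q); [intros []; reflexivity|].
  apply continuous_id.
Qed.

Lemma graph_connected u : continuous01 u -> connected2 (graph u).
Proof.
  intros cu.
  assert (H := segment_image_connected 0 1 (fun t => (clamp 0 1 t, ext01 u t))
    ltac:(intros; apply continuous_pair; [apply continuous_clamp | apply cu])).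
  intros U V oU oV cov EU EV.
  assert (eq : forall p, graph u p <->
     exists t, 0 <= t <= 1 /\ p = (clamp 0 1 t, ext01 u t)).
  { intros [t x]; split.
    - intros [Ht E]; simpl in *; exists t; split; [exact Ht|].
      rewrite ext01_id, clamp_id by exact Ht; congruence.
    - intros [s [Hs E]]; rewrite ext01_id, clamp_id in E by exact Hs.
      injection E as -> ->; split; [exact Hs | reflexivity]. }
  destruct (H U V oU oV) as [p [Hp K]].
  - intros p Hp; apply cov, eq, Hp.
  - destruct EU as [p [Hp Up]]; exists p; split; [apply eq, Hp | exact Up].
  - destruct EV as [p [Hp Vp]]; exists p; split; [apply eq, Hp | exact Vp].
  - exists p; split; [apply eq, Hp | exact K].
Qed.

Lemma conn_sym Z p q : conn Z p q -> conn Z q p.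
Proof. intros [K [H1 [H2 [H3 H4]]]]; exists K; auto. Qed.

Lemma connected2_union (K1 K2 : R * R -> Prop) q :
  connected2 K1 -> connected2 K2 -> K1 q -> K2 q -> connected2 (fun p => K1 p \/ K2 p).
Proof.
  intros H1 H2 q1 q2 U V oU oV cov [p [Kp Up]] [r [Kr Vr]].
  destruct (classic (exists p, (K1 p \/ K2 p) /\ U p /\ V p)) as [Y|N]; [exact Y|].
  assert (side : forall K : R * R -> Prop, connected2 K -> K q ->
    (forall p, K p -> K1 p \/ K2 p) ->
    (U q -> forall p, K p -> ~ V p) /\ (V q -> forall p, K p -> ~ U p)).
  { intros K HK Kq sub; split; intros Q x Kx X; apply N;
    destruct (HK U V oU oV) as [y [Ky Hy]]; eauto; exists y; auto. }
  destruct (side K1 H1 q1 ltac:(auto)) as [a1 b1].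
  destruct (side K2 H2 q2 ltac:(auto)) as [a2 b2].
  exfalso; destruct (cov q (or_introl q1)) as [Q|Q].
  - destruct Kr as [Kr|Kr]; [apply (a1 Q r) | apply (a2 Q r)]; assumption.
  - destruct Kp as [Kp|Kp]; [apply (b1 Q p) | apply (b2 Q p)]; assumption.
Qed.

Lemma conn_trans Z p q r : conn Z p q -> conn Z q r -> conn Z p r.
Proof.
  intros [K [H1 [H2 [H3 H4]]]] [J [J1 [J2 [J3 J4]]]].
  exists (fun p => K p \/ J p); split; [|split; [|auto]].
  - apply connected2_union with q; assumption.
  - intros x [Hx|Hx]; auto.
Qed.

(** The graph of [z] cuts the strip into two open sides. Applied with [K] inside [{f = 0}] and [z] a
    solution on which [f] does not vanish. *)
Lemma connected2_one_side (K : R * R -> Prop) (z : R -> R) :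
  connected2 K -> continuous01 z ->
  (forall p, K p -> in01 (fst p)) -> (forall p, K p -> snd p <> z (fst p)) ->
  (exists p, K p /\ snd p < z (fst p)) -> forall p, K p -> snd p < z (fst p).
Proof.
  intros HK cz K01 Kz [q [Kq Hq]] p Kp.
  set (D := fun p : R * R => ext01 z (fst p) - snd p).
  assert (cD : forall p, continuous D p).
  { intros x; unfold D.
    apply (continuous_minus (fun p : R * R => ext01 z (fst p)) snd).
    - apply continuous_comp; [apply continuous_fst | apply cz].
    - apply continuous_snd. }
  assert (DE : forall p, K p -> D p = z (fst p) - snd p).
  { intros x Kx; unfold D; rewrite ext01_id; auto. }
  apply Rnot_le_lt; intros Hp.
  destruct (HK (fun p => 0 < D p) (fun p => D p < 0)) as [x [Kx [X1 X2]]].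
  - apply (open_comp D (fun x => 0 < x)); [intros; apply cD | apply open_gt].
  - apply (open_comp D (fun x => x < 0)); [intros; apply cD | apply open_lt].
  - intros x Kx; rewrite (DE x Kx). specialize (Kz x Kx). lra.
  - exists q; split; [exact Kq|]; rewrite (DE q Kq); lra.
  - exists p; split; [exact Kp|]; rewrite (DE p Kp). specialize (Kz p Kp); lra.
  - lra.
Qed.

(** Tube lemma around [[0,1]] times [{x}]. The radii are chosen as a function for
    [compactness_value_1d], whose doubly negated conclusion is removed classically. *)
Lemma tube (W : R -> R -> Prop) x :
  (forall t, in01 t -> exists d, 0 < d /\
     forall s y, Rabs (s - t) < d -> Rabs (y - x) < d -> W s y) ->
  exists d, 0 < d /\ forall y, Rabs (y - x) < d -> forall t, in01 t -> W t y.
Proof.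
  intros H.
  assert (H' : forall t, exists d : posreal, in01 t ->
     forall s y, Rabs (s - t) < d -> Rabs (y - x) < d -> W s y).
  { intros t; destruct (classic (in01 t)) as [Ht|Ht].
    - destruct (H t Ht) as [d [d0 Hd]]; exists (mkposreal d d0); auto.
    - exists (mkposreal 1 Rlt_0_1); tauto. }
  destruct (compactness_value_1d 0 1
    (fun t => proj1_sig (constructive_indefinite_description _ (H' t)))) as [d Hd].
  exists d; split; [apply cond_pos|]; intros y Hy t Ht.
  apply NNPP; intros N; apply (Hd t Ht); intros [s [Hs [K1 K2]]]; apply N.
  destruct (constructive_indefinite_description _ (H' s)) as [e He]; simpl in *.
  apply He; [exact Hs | exact K1 | lra].
Qed.

(** * Zero sets of functions whose sign increases in time; [x] stands for the initial value of a
    trajectory *)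

Section SignMonotoneBand.

Context (g : R -> R -> R) (a b : R).
Context (g_cont : forall p : R * R, continuous (fun q : R * R => g (fst q) (snd q)) p)
  (g_nneg : forall x s t, a <= x <= b -> 0 <= s <= t -> t <= 1 -> 0 <= g s x -> 0 <= g t x)
  (g_pos : forall x s t, a <= x <= b -> 0 <= s <= t -> t <= 1 -> 0 < g s x -> 0 < g t x).

Lemma band_slice_continuous_fst x t : continuous (fun t => g t x) t.
Proof.
  apply (continuous_comp_2 (fun t => t) (fun _ => x) g);
    [apply continuous_id | apply continuous_const | apply (g_cont (t, x))].
Qed.

Lemma band_slice_continuous_snd x t : continuous (fun x => g t x) x.
Proof.
  apply (continuous_comp_2 (fun _ => t) (fun x => x) g);
    [apply continuous_const | apply continuous_id | apply (g_cont (t, x))].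
Qed.

Lemma band_nonzero_open t x : g t x <> 0 ->
  exists d, 0 < d /\ forall s y, Rabs (s - t) < d -> Rabs (y - x) < d -> g s y <> 0.
Proof.
  intros H.
  apply (open_prod_eps (fun p => g (fst p) (snd p) <> 0) t x); [|exact H].
  apply (open_comp (fun p : R * R => g (fst p) (snd p)) (fun z => z <> 0));
    [intros p _; apply g_cont | apply open_neq].
Qed.

(* Fibres over [x] are intervals of times, depending upper semicontinuously on [x]. *)
Lemma band_connected c d : a <= c <= d -> d <= b ->
  (forall x, c <= x <= d -> g 0 x <= 0 <= g 1 x) ->
  connected2 (fun p => in01 (fst p) /\ c <= snd p <= d /\ g (fst p) (snd p) = 0).
Proof.
  intros cd db H U V oU oV cov [[tp xp] [Kp Up]] [[tq xq] [Kq Vq]]; simpl in *.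
  apply NNPP; intros N.
  (* Between two zeros of one fibre the sign monotonicity leaves only zeros, so a fibre is an
     interval and cannot be split by [U] and [V]. *)
  assert (fibre : forall (U V : R * R -> Prop), open U -> open V ->
    (forall p, in01 (fst p) /\ c <= snd p <= d /\ g (fst p) (snd p) = 0 -> U p \/ V p) ->
    (~ exists p, (in01 (fst p) /\ c <= snd p <= d /\ g (fst p) (snd p) = 0) /\ U p /\ V p) ->
    forall x s t, c <= x <= d -> in01 s -> in01 t -> g s x = 0 -> g t x = 0 ->
    s <= t -> U (s, x) -> V (t, x) -> False).
  { clear - cd db g_nneg g_pos.
    intros U V oU oV cov N x s t Hx [Hs0 Hs1] [Ht0 Ht1] gs gt st Us Vt.
    assert (Z : forall r, s <= r <= t -> g r x = 0).
    { intros r Hr; apply Rle_antisym.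
      - apply Rnot_lt_le; intros P.
        assert (0 < g t x) by (apply (g_pos x r t); try lra; exact P). lra.
      - apply (g_nneg x s r); lra. }
    destruct (interval_connected (fun r => U (r, x)) (fun r => V (r, x)) s t)
      as [r [Hr [Ur Vr]]].
    - intros r _ Hr; apply (open_relative (fun r => U (r, x)));
        [apply open_slice_fst; exact oU | exact Hr].
    - intros r _ Hr; apply (open_relative (fun r => V (r, x)));
        [apply open_slice_fst; exact oV | exact Hr].
    - intros r Hr; apply cov; simpl; repeat split; try lra; apply Z; lra.
    - exists s; split; [lra | exact Us].
    - exists t; split; [lra | exact Vt].
    - apply N; exists (r, x); simpl; split; [|split; assumption].
      repeat split; try lra; apply Z; lra. }
  assert (cov' : forall p, in01 (fst p) /\ c <= snd p <= d /\ g (fst p) (snd p) = 0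
     -> V p \/ U p) by (intros p Hp; destruct (cov p Hp); auto).
  assert (N' : ~ exists p, (in01 (fst p) /\ c <= snd p <= d /\ g (fst p) (snd p) = 0)
     /\ V p /\ U p) by (intros [p [K1 [K2 K3]]]; apply N; exists p; auto).
  assert (excl : forall x s t, c <= x <= d -> in01 s -> in01 t ->
     g s x = 0 -> g t x = 0 -> U (s, x) -> V (t, x) -> False).
  { intros x s t Hx Hs Ht gs gt Us Vt.
    destruct (Rle_dec s t) as [l|l].
    - apply (fibre U V oU oV cov N x s t); assumption.
    - apply (fibre V U oV oU cov' N' x t s); try assumption; lra. }
  assert (has_zero : forall x, c <= x <= d -> exists t, in01 t /\ g t x = 0).
  { intros x Hx; destruct (IVT_continuous (fun t => g t x) 0 1 0) as [t Ht].
    - lra.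
    - intros; apply band_slice_continuous_fst.
    - left; apply H; exact Hx.
    - exists t; exact Ht. }
  (* Upper semicontinuity: over [x] each time has either [g <> 0] or a point of [P]. Both conditions
     are open, and [tube] makes the radius uniform in time. *)
  assert (opn : forall (P Q : R * R -> Prop), open P ->
    (forall p, in01 (fst p) /\ c <= snd p <= d /\ g (fst p) (snd p) = 0 -> P p \/ Q p) ->
    (forall x s t, c <= x <= d -> in01 s -> in01 t ->
     g s x = 0 -> g t x = 0 -> P (s, x) -> Q (t, x) -> False) ->
    forall x, c <= x <= d -> (exists t, in01 t /\ g t x = 0 /\ P (t, x)) ->
    exists e, 0 < e /\ forall y, c <= y <= d -> Rabs (y - x) < e ->
      exists t, in01 t /\ g t y = 0 /\ P (t, y)).
  { intros P Q oP cv ex x Hx [s [Hs [gs Ps]]].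
    destruct (tube (fun t y => g t y <> 0 \/ P (t, y)) x) as [e [e0 He]].
    - intros t Ht; destruct (Req_dec (g t x) 0) as [gt|gt].
      + destruct (cv (t, x)) as [Pt|Qt]; [simpl; auto| |].
        * destruct (open_prod_eps P t x oP Pt) as [e [e0 He]]; exists e.
          split; [exact e0|]; intros r y Hr Hy; right; apply (He r y Hr Hy).
        * exfalso; apply (ex x s t); assumption.
      + destruct (band_nonzero_open t x gt) as [e [e0 He]]; exists e; split; [exact e0|].
        intros r y Hr Hy; left; apply (He r y Hr Hy).
    - exists e; split; [exact e0|]; intros y Hy Hxy.
      destruct (has_zero y Hy) as [t [Ht gt]].
      exists t; split; [exact Ht|split; [exact gt|]].
      destruct (He y Hxy t Ht); [contradiction | assumption]. }
  destruct (interval_connected (fun x => exists t, in01 t /\ g t x = 0 /\ U (t, x))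
    (fun x => exists t, in01 t /\ g t x = 0 /\ V (t, x)) c d)
    as [x [Hx [[s [Hs [gs Us]]] [t [Ht [gt Vt]]]]]].
  - intros x Hx; apply (opn U V oU cov excl x Hx).
  - intros x Hx; apply (opn V U oV cov'); [|exact Hx].
    intros y s t Hy Hs Ht gs gt Vs Ut; apply (excl y t s); assumption.
  - intros x Hx; destruct (has_zero x Hx) as [t [Ht gt]].
    destruct (cov (t, x)) as [Ut|Vt]; [simpl; auto|left|right]; exists t; auto.
  - exists xp; split; [tauto|]; exists tp; tauto.
  - exists xq; split; [tauto|]; exists tq; tauto.
  - apply (excl x s t); assumption.
Qed.

End SignMonotoneBand.

(** [c] is the supremum of [{k <= 0}], so positivity past [c] is immediate. *)
Lemma last_zero (k : R -> R) a b :
  a <= b -> (forall x, continuous k x) -> k a <= 0 <= k b ->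
  exists c, a <= c <= b /\ k c = 0 /\ forall x, c < x <= b -> 0 < k x.
Proof.
  intros ab ck H.
  destruct (completeness (fun x => a <= x <= b /\ k x <= 0)) as [c [Hc1 Hc2]].
  { exists b; intros x Hx; apply Hx. }
  { exists a; split; lra. }
  assert (ac : a <= c) by (apply Hc1; split; lra).
  assert (cb : c <= b) by (apply Hc2; intros x Hx; apply Hx).
  exists c; split; [lra|split].
  - apply Rle_antisym.
    + apply Rnot_lt_le; intros P.
      destruct (proj1 (continuous_eps k c) (ck c) (k c) P) as [d [d0 Hd]].
      assert (c <= c - d); [|lra]. apply Hc2; intros x [Hx kx].
      apply Rnot_lt_le; intros L.
      assert (x <= c) by (apply Hc1; split; assumption).
      specialize (Hd x ltac:(apply Rabs_def1; lra)). apply Rabs_lt_between in Hd; lra.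
    + apply Rnot_lt_le; intros P.
      destruct (IVT_continuous k c b 0 cb ck) as [x [Hx kx]]; [lra|].
      assert (x <= c) by (apply Hc1; split; lra).
      assert (x = c) by lra. subst x; lra.
  - intros x Hx; apply Rnot_le_lt; intros P.
    assert (x <= c) by (apply Hc1; split; [lra | exact P]). lra.
Qed.

Lemma first_zero (k : R -> R) a b :
  a <= b -> (forall x, continuous k x) -> k a <= 0 <= k b ->
  exists c, a <= c <= b /\ k c = 0 /\ forall x, a <= x < c -> k x < 0.
Proof.
  intros ab ck H.
  destruct (last_zero (fun x => - k (- x)) (- b) (- a)) as [c [Hc [kc Hpos]]].
  - lra.
  - intros x; apply (continuous_opp (fun x => k (- x))).
    apply (continuous_comp (fun x : R => - x) k); [|apply ck].
    apply (continuous_opp (fun x : R => x)), continuous_id.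
  - rewrite !Ropp_involutive; lra.
  - exists (- c); split; [lra|split; [lra|]].
    intros x Hx; specialize (Hpos (- x)); rewrite Ropp_involutive in Hpos; lra.
Qed.

(** The band is cut down to [[c, d]], with [d] the first zero of [g 0] and [c] the last zero of
    [g 1] before [d]. On it [g 0 <= 0 <= g 1], so every fibre is nonempty, and the two edges supply
    the end points at times 0 and 1. *)
Lemma crossing_band_neg_pos (g : R -> R -> R) a b :
  a < b ->
  (forall p : R * R, continuous (fun q : R * R => g (fst q) (snd q)) p) ->
  (forall x s t, a <= x <= b -> 0 <= s <= t -> t <= 1 -> 0 <= g s x -> 0 <= g t x) ->
  (forall x s t, a <= x <= b -> 0 <= s <= t -> t <= 1 -> 0 < g s x -> 0 < g t x) ->
  (forall t, in01 t -> g t a < 0) -> (forall t, in01 t -> 0 < g t b) ->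
  exists K, connected2 K /\
    (forall p, K p -> in01 (fst p) /\ a <= snd p <= b /\ g (fst p) (snd p) = 0) /\
    joins01 K.
Proof.
  intros ab cg gn gp Ha Hb.
  assert (I0 : in01 0) by (split; lra). assert (I1 : in01 1) by (split; lra).
  assert (cs : forall t x, continuous (fun x => g t x) x)
    by (intros; apply band_slice_continuous_snd; exact cg).
  destruct (first_zero (fun x => g 0 x) a b) as [d [Hd [gd Hneg]]].
  { lra. } { apply cs. } { specialize (Ha 0 I0); specialize (Hb 0 I0); lra. }
  assert (g1d : 0 <= g 1 d) by (apply (gn d 0 1); lra).
  destruct (last_zero (fun x => g 1 x) a d) as [c [Hc [gc Hpos]]].
  { lra. } { apply cs. } { specialize (Ha 1 I1); lra. }
  exists (fun p => in01 (fst p) /\ c <= snd p <= d /\ g (fst p) (snd p) = 0).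
  split; [|split; [|split]].
  - apply (band_connected g a b cg gn gp); try lra.
    intros x Hx; split.
    + destruct (Rle_lt_or_eq_dec x d) as [l|E]; [lra| |subst x; lra].
      left; apply Hneg; lra.
    + destruct (Rle_lt_or_eq_dec c x) as [l|E]; [lra| |subst x; lra].
      left; apply Hpos; lra.
  - intros p [H1 [H2 H3]]; repeat split; try apply H1; try lra.
  - exists (0, d); simpl; repeat split; lra.
  - exists (1, c); simpl; repeat split; lra.
Qed.

Lemma crossing_band (g : R -> R -> R) a b :
  a < b ->
  (forall p : R * R, continuous (fun q : R * R => g (fst q) (snd q)) p) ->
  (forall x s t, a <= x <= b -> 0 <= s <= t -> t <= 1 -> 0 <= g s x -> 0 <= g t x) ->
  (forall x s t, a <= x <= b -> 0 <= s <= t -> t <= 1 -> 0 < g s x -> 0 < g t x) ->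
  (forall t, in01 t -> g t a < 0) /\ (forall t, in01 t -> 0 < g t b) \/
  (forall t, in01 t -> 0 < g t a) /\ (forall t, in01 t -> g t b < 0) ->
  exists K, connected2 K /\
    (forall p, K p -> in01 (fst p) /\ a <= snd p <= b /\ g (fst p) (snd p) = 0) /\
    joins01 K.
Proof.
  intros ab cg gn gp [[Ha Hb]|[Ha Hb]].
  - apply crossing_band_neg_pos; assumption.
  - assert (c1 : forall p : R * R, continuous (fun q : R * R => 1 - fst q) p).
    { intros p; apply (continuous_minus (fun _ : R * R => 1) fst);
        [apply continuous_const | apply continuous_fst]. }
    assert (inv : forall t, in01 t -> in01 (1 - t)) by (intros t []; split; lra).
    (* Time reversal with a change of sign keeps the sign monotonicity: [gp] and [gn] exchange roles
       by contraposition. *)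
    destruct (crossing_band_neg_pos (fun t x => - g (1 - t) x) a b)
      as [K [cK [HK [[p [Kp p0]] [q [Kq q1]]]]]].
    + exact ab.
    + intros p; apply (continuous_opp (fun q : R * R => g (1 - fst q) (snd q))).
      apply (continuous_comp_2 (fun q : R * R => 1 - fst q) snd g);
        [apply c1 | apply continuous_snd | apply cg].
    + intros x s t Hx Hs Ht H.
      assert (g (1 - t) x <= 0); [|lra]. apply Rnot_lt_le; intros P.
      assert (0 < g (1 - s) x) by (apply (gp x (1 - t)); try lra; exact P). lra.
    + intros x s t Hx Hs Ht H.
      assert (g (1 - t) x < 0); [|lra]. apply Rnot_le_lt; intros P.
      assert (0 <= g (1 - s) x) by (apply (gn x (1 - t)); try lra; exact P). lra.
    + intros t Ht; specialize (Ha _ (inv t Ht)); lra.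
    + intros t Ht; specialize (Hb _ (inv t Ht)); lra.
    + exists (fun q => exists p, K p /\ q = (1 - fst p, snd p)).
      split; [|split; [|split]].
      * apply connected2_image; [|exact cK].
        intros x; apply continuous_pair; [apply c1 | apply continuous_snd].
      * intros r [x [Kx Er]]; subst r; simpl.
        destruct (HK x Kx) as [H1 [H2 H3]].
        split; [apply inv; exact H1 | split; [exact H2 | lra]].
      * exists (1 - fst q, snd q); split; [exists q; auto|]. rewrite q1; simpl; lra.
      * exists (1 - fst p, snd p); split; [exists p; auto|]. rewrite p0; simpl; lra.
Qed.

(** * Rectangles are not null *)

(** Length of the intersection of [[a, b]] and [[c, d]]. *)
Definition overlap (a b c d : R) : R := Rmax 0 (Rmin b d - Rmax a c).

(* Innermost comparisons first, so that no [if] is left inside a hypothesis. *)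
Ltac split_minmax :=
  unfold Rmax, Rmin;
  repeat match goal with
  | |- context [Rle_dec ?x ?y] =>
      lazymatch x with
      | context [Rle_dec _ _] => fail
      | _ => lazymatch y with
             | context [Rle_dec _ _] => fail
             | _ => destruct (Rle_dec x y); try lra
             end
      end
  end; lra.

Lemma overlap_nneg a b c d : 0 <= overlap a b c d.
Proof. apply Rmax_l. Qed.

Lemma overlap_split a b c m d : c <= m <= d ->
  overlap a b c d = overlap a b c m + overlap a b m d.
Proof.
  intros H; unfold overlap; split_minmax.
Qed.

Lemma overlap_le a b c d : a <= b -> overlap a b c d <= b - a.
Proof.
  intros H; unfold overlap; split_minmax.
Qed.

Lemma overlap_full a b c d : a <= c -> c <= d -> d <= b -> overlap a b c d = d - c.
Proof.
  intros; unfold overlap; split_minmax.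
Qed.

Lemma sum_f_R0_mono (u : nat -> R) n m : (forall k, 0 <= u k) -> (n <= m)%nat ->
  sum_f_R0 u n <= sum_f_R0 u m.
Proof.
  intros Hu; induction 1 as [|m _ IH]; [right; reflexivity|].
  simpl; specialize (Hu (S m)); lra.
Qed.

Lemma sum_f_R0_term (u : nat -> R) n : (forall k, 0 <= u k) -> u n <= sum_f_R0 u n.
Proof.
  intros Hu; destruct n as [|n]; simpl; [right; reflexivity|].
  assert (0 <= sum_f_R0 u n) by (apply cond_pos_sum; exact Hu). lra.
Qed.

Lemma nested_intervals (p q : nat -> R) :
  (forall k, p k <= p (S k)) -> (forall k, q (S k) <= q k) -> (forall k, p k <= q k) ->
  exists x, forall k, p k <= x <= q k.
Proof.
  intros Hp Hq Hpq.
  assert (Mp : forall i j, (i <= j)%nat -> p i <= p j)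
    by (induction 1; [lra | eapply Rle_trans; [eassumption | apply Hp]]).
  assert (Mq : forall i j, (i <= j)%nat -> q j <= q i)
    by (induction 1; [lra | eapply Rle_trans; [apply Hq | eassumption]]).
  assert (X : forall i j, p i <= q j).
  { intros i j. apply Rle_trans with (p (max i j)); [apply Mp; lia|].
    apply Rle_trans with (q (max i j)); [apply Hpq | apply Mq; lia]. }
  destruct (completeness (fun y => exists k, y = p k)) as [x [Hx1 Hx2]].
  { exists (q 0%nat); intros y [k E]; subst y; apply X. }
  { exists (p 0%nat), 0%nat; reflexivity. }
  exists x; intros k; split; [apply Hx1; exists k; reflexivity|].
  apply Hx2; intros y [i E]; subst y; apply X.
Qed.

Definition rect : Type := ((R * R) * (R * R))%type.

Definition rect_half (Q Q' : rect) : Prop :=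
  let '((p, q), (r, s)) := Q in let '((p', q'), (r', s')) := Q' in
  p <= p' /\ q' <= q /\ q' - p' = (q - p) / 2 /\
  r <= r' /\ s' <= s /\ s' - r' = (s - r) / 2.

Section Bisection.

Context (a b c d : nat -> R).

Definition covered_sum (p q r s : R) (N : nat) : R :=
  sum_f_R0 (fun n => overlap (a n) (b n) p q * overlap (c n) (d n) r s) N.

(** The covering rectangles fill at most half of [Q], counted with multiplicity. Both sides of the
    inequality are additive, so one of two halves of a sparse rectangle is sparse. *)
Definition sparse (Q : rect) : Prop :=
  let '((p, q), (r, s)) := Q in
  p < q /\ r < s /\ forall N, covered_sum p q r s N <= / 2 * ((q - p) * (s - r)).

Lemma overlap_area_nneg p q r s n :
  0 <= overlap (a n) (b n) p q * overlap (c n) (d n) r s.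
Proof. apply Rmult_le_pos; apply overlap_nneg. Qed.

Lemma sparse_half_fst p q r s : sparse ((p, q), (r, s)) ->
  sparse ((p, (p + q) / 2), (r, s)) \/ sparse (((p + q) / 2, q), (r, s)).
Proof.
  intros [pq [rs H]]; apply NNPP; intros N.
  assert (E1 : exists n1, / 2 * (((p + q) / 2 - p) * (s - r)) < covered_sum p ((p + q) / 2) r s n1).
  { apply NNPP; intros N1; apply N; left; split; [lra|split; [lra|]].
    intros n; apply Rnot_lt_le; intros L; apply N1; exists n; exact L. }
  assert (E2 : exists n2, / 2 * ((q - (p + q) / 2) * (s - r)) < covered_sum ((p + q) / 2) q r s n2).
  { apply NNPP; intros N1; apply N; right; split; [lra|split; [lra|]].
    intros n; apply Rnot_lt_le; intros L; apply N1; exists n; exact L. }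
  destruct E1 as [n1 L1]. destruct E2 as [n2 L2].
  set (m := max n1 n2).
  assert (K1 : covered_sum p ((p + q) / 2) r s n1 <= covered_sum p ((p + q) / 2) r s m)
    by (apply sum_f_R0_mono; [intros; apply overlap_area_nneg | lia]).
  assert (K2 : covered_sum ((p + q) / 2) q r s n2 <= covered_sum ((p + q) / 2) q r s m)
    by (apply sum_f_R0_mono; [intros; apply overlap_area_nneg | lia]).
  assert (E : covered_sum p q r s m =
    covered_sum p ((p + q) / 2) r s m + covered_sum ((p + q) / 2) q r s m).
  { unfold covered_sum; rewrite <- plus_sum; apply sum_eq; intros n _.
    rewrite (overlap_split (a n) (b n) p ((p + q) / 2) q) by lra; ring. }
  specialize (H m). lra.
Qed.

End Bisection.

(** Lets the halving of the first coordinate serve for the second. *)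
Lemma sparse_swap a b c d p q r s :
  sparse a b c d ((p, q), (r, s)) -> sparse c d a b ((r, s), (p, q)).
Proof.
  intros [pq [rs H]]; split; [exact rs|split; [exact pq|]].
  intros N; specialize (H N). rewrite (Rmult_comm (s - r)).
  replace (covered_sum c d a b r s p q N) with (covered_sum a b c d p q r s N);
    [exact H|].
  apply sum_eq; intros n _; apply Rmult_comm.
Qed.

Lemma sparse_quarter a b c d Q : sparse a b c d Q ->
  exists Q', sparse a b c d Q' /\ rect_half Q Q'.
Proof.
  destruct Q as [[p q] [r s]]; intros H.
  assert (X : exists p' q', p <= p' /\ q' <= q /\ q' - p' = (q - p) / 2 /\
    sparse a b c d ((p', q'), (r, s))).
  { assert (pq : p < q) by apply H.
    destruct (sparse_half_fst a b c d p q r s H) as [K|K];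
      eexists; eexists; (split; [|split; [|split; [|exact K]]]); lra. }
  destruct X as [p' [q' [X1 [X2 [X3 K]]]]]. apply sparse_swap in K.
  assert (rs : r < s) by apply K.
  destruct (sparse_half_fst c d a b r s p' q' K) as [J|J]; apply sparse_swap in J;
    eexists; (split; [exact J|]); simpl; repeat split; try assumption; lra.
Qed.

(** Repeated quartering shrinks to a point. If an open covering rectangle contained it, a late
    quarter would be covered completely by that rectangle alone. *)
Lemma rectangle_not_sparse a b c d Q : sparse a b c d Q ->
  exists x y, fst (fst Q) <= x <= snd (fst Q) /\ fst (snd Q) <= y <= snd (snd Q) /\
    forall n, ~ (a n < x < b n /\ c n < y < d n).
Proof.
  intros H0.
  (* Dependent choice wants a successor of every rectangle, so the relation is vacuous at those that
     are not sparse. *)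
  destruct (fun H => @dependent_choice rect (fun Q Q' => sparse a b c d Q ->
     sparse a b c d Q' /\ rect_half Q Q') H Q) as [h [h0 hS]].
  { intros x; apply constructive_indefinite_description.
    destruct (classic (sparse a b c d x)) as [K|K].
    - destruct (sparse_quarter a b c d x K) as [y Hy]; exists y; intros _; exact Hy.
    - exists x; contradiction. }
  assert (sp : forall k, sparse a b c d (h k)).
  { induction k as [|k IH]; [rewrite h0; exact H0 | apply hS, IH]. }
  assert (hf : forall k, rect_half (h k) (h (S k))) by (intros k; apply hS, sp).
  set (p := fun k => fst (fst (h k))). set (q := fun k => snd (fst (h k))).
  set (r := fun k => fst (snd (h k))). set (s := fun k => snd (snd (h k))).
  assert (hE : forall k, h k = ((p k, q k), (r k, s k)))
    by (intros k; unfold p, q, r, s; destruct (h k) as [[] []]; reflexivity).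
  assert (hf' : forall k, p k <= p (S k) /\ q (S k) <= q k /\
     q (S k) - p (S k) = (q k - p k) / 2 /\ r k <= r (S k) /\ s (S k) <= s k /\
     s (S k) - r (S k) = (s k - r k) / 2).
  { intros k; specialize (hf k); rewrite !hE in hf; exact hf. }
  assert (sp' : forall k, p k < q k /\ r k < s k /\
     forall N, covered_sum a b c d (p k) (q k) (r k) (s k) N
       <= / 2 * ((q k - p k) * (s k - r k))).
  { intros k; specialize (sp k); rewrite hE in sp; exact sp. }
  destruct (nested_intervals p q) as [x Hx]; try (intros k; apply hf');
    [intros k; left; apply sp'|].
  destruct (nested_intervals r s) as [y Hy]; try (intros k; apply hf');
    [intros k; left; apply sp'|].
  exists x, y. rewrite <- h0. split; [apply (Hx 0%nat)|split; [apply (Hy 0%nat)|]].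
  intros n [Hn1 Hn2].
  assert (wx : forall k, q k - p k = (q 0%nat - p 0%nat) * (/ 2) ^ k).
  { induction k as [|k IH]; [simpl; ring|].
    destruct (hf' k) as [_ [_ [E _]]]; rewrite E, IH; simpl; field. }
  assert (wy : forall k, s k - r k = (s 0%nat - r 0%nat) * (/ 2) ^ k).
  { induction k as [|k IH]; [simpl; ring|].
    destruct (hf' k) as [_ [_ [_ [_ [_ E]]]]]; rewrite E, IH; simpl; field. }
  (* Distance from the limit point to the boundary of rectangle [n]; a quarter with side sum below
     [e] lies inside it. *)
  set (e := Rmin (Rmin (x - a n) (b n - x)) (Rmin (y - c n) (d n - y))).
  assert (e0 : 0 < e) by (repeat apply Rmin_pos; lra).
  assert (m1 := Rmin_l (Rmin (x - a n) (b n - x)) (Rmin (y - c n) (d n - y))).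
  assert (m2 := Rmin_r (Rmin (x - a n) (b n - x)) (Rmin (y - c n) (d n - y))).
  fold e in m1, m2.
  assert (m3 := Rmin_l (x - a n) (b n - x)). assert (m4 := Rmin_r (x - a n) (b n - x)).
  assert (m5 := Rmin_l (y - c n) (d n - y)). assert (m6 := Rmin_r (y - c n) (d n - y)).
  destruct (sp' 0%nat) as [u0 [v0 _]].
  destruct (half_pow_small ((q 0%nat - p 0%nat) + (s 0%nat - r 0%nat)) e) as [k Hk];
    [lra | exact e0|].
  assert (pk : 0 < (/ 2) ^ k) by (apply pow_lt; lra).
  assert (j1 : 0 < (q 0%nat - p 0%nat) * (/ 2) ^ k) by (apply Rmult_lt_0_compat; lra).
  assert (j2 : 0 < (s 0%nat - r 0%nat) * (/ 2) ^ k) by (apply Rmult_lt_0_compat; lra).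
  rewrite Rmult_plus_distr_r, <- wx, <- wy in Hk.
  rewrite <- wx in j1. rewrite <- wy in j2.
  specialize (Hx k); specialize (Hy k).
  destruct (sp' k) as [_ [_ HS]]; specialize (HS n).
  assert (T := sum_f_R0_term
    (fun n => overlap (a n) (b n) (p k) (q k) * overlap (c n) (d n) (r k) (s k)) n
    (overlap_area_nneg a b c d (p k) (q k) (r k) (s k))).
  unfold covered_sum in HS. simpl in T.
  rewrite (overlap_full (a n) (b n)) in T by lra.
  rewrite (overlap_full (c n) (d n)) in T by lra.
  assert (0 < (q k - p k) * (s k - r k)) by (apply Rmult_lt_0_compat; assumption).
  lra.
Qed.

Lemma sum_half_pow_le e N : 0 <= e -> sum_f_R0 (fun n => e * (/ 2) ^ n) N <= 2 * e.
Proof.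
  intros He.
  assert (E : sum_f_R0 (fun n => e * (/ 2) ^ n) N = 2 * e - e * (/ 2) ^ N).
  { induction N as [|N IH]; simpl; [ring|]. rewrite IH; simpl; field. }
  rewrite E. assert (0 <= e * (/ 2) ^ N)
    by (apply Rmult_le_pos; [exact He | apply pow_le; lra]). lra.
Qed.

Lemma rectangle_not_null p q r s : p < q -> r < s ->
  ~ null2 (fun x => p <= fst x <= q /\ r <= snd x <= s).
Proof.
  intros pq rs H. set (A := (q - p) * (s - r)).
  assert (A0 : 0 < A) by (apply Rmult_lt_0_compat; lra).
  (* Budget: [A / 4] for the cover and [2 e = A / 4] for fattening its closed rectangles into open
     ones, in total the [A / 2] allowed by [sparse]. *)
  destruct (H (A / 4)) as [a [b [c [d [Hle [Hcov Hsum]]]]]]; [lra|].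
  set (e := A / 8).
  (* Fattening by [dl] adds [dl * (2 * (sum of sides) + 4 * dl)] to the area. The denominator forces
     [dl <= 1] and keeps this below [e / 2^n]. *)
  set (dl := fun n => e * (/ 2) ^ n / (2 * ((b n - a n) + (d n - c n)) + 4 + e)).
  assert (hp : forall n, 0 < (/ 2) ^ n <= 1).
  { intros n; split; [apply pow_lt; lra|].
    replace 1 with (1 ^ n) by apply pow1. apply pow_incr; lra. }
  assert (den : forall n, 0 < 2 * ((b n - a n) + (d n - c n)) + 4 + e)
    by (intros n; destruct (Hle n); unfold e; lra).
  assert (dl0 : forall n, 0 < dl n).
  { intros n; apply Rdiv_lt_0_compat; [apply Rmult_lt_0_compat; [unfold e; lra | apply hp]|].
    apply den. }
  assert (dlE : forall n, dl n * (2 * ((b n - a n) + (d n - c n)) + 4 + e) = e * (/ 2) ^ n)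
    by (intros n; unfold dl; field; specialize (den n); lra).
  assert (area : forall n, (b n - a n + 2 * dl n) * (d n - c n + 2 * dl n) <=
    (b n - a n) * (d n - c n) + e * (/ 2) ^ n).
  { intros n; rewrite <- dlE. destruct (Hle n) as [L1 L2].
    assert (e0 : 0 < e) by (unfold e; lra).
    assert (dl n <= 1).
    { specialize (dlE n); specialize (hp n); specialize (dl0 n).
      apply Rnot_lt_le; intros K. nra. }
    specialize (dl0 n). nra. }
  destruct (rectangle_not_sparse (fun n => a n - dl n) (fun n => b n + dl n)
    (fun n => c n - dl n) (fun n => d n + dl n) ((p, q), (r, s)))
    as [x [y [Hx [Hy Hn]]]].
  - split; [exact pq|split; [exact rs|]]. fold A. intros N.
    apply Rle_trans with
      (sum_f_R0 (fun n => (b n - a n) * (d n - c n) + e * (/ 2) ^ n) N).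
    + apply sum_Rle; intros n _.
      eapply Rle_trans; [|apply area].
      destruct (Hle n) as [L1 L2]; specialize (dl0 n).
      apply Rmult_le_compat; try apply overlap_nneg.
      * eapply Rle_trans; [apply overlap_le; lra | lra].
      * eapply Rle_trans; [apply overlap_le; lra | lra].
    + rewrite plus_sum. specialize (Hsum N).
      assert (K := sum_half_pow_le e N ltac:(unfold e; lra)). unfold e in *; lra.
  - simpl in Hx, Hy.
    destruct (Hcov (x, y)) as [n [K1 K2]]; [simpl; auto|]; simpl in *.
    apply (Hn n); specialize (dl0 n); lra.
Qed.

Lemma null2_subset (Y Z : R * R -> Prop) : (forall p, Y p -> Z p) -> null2 Z -> null2 Y.
Proof.
  intros YZ H eps He; destruct (H eps He) as [a [b [c [d [H1 [H2 H3]]]]]].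
  exists a, b, c, d; split; [exact H1|split; [intros p Hp; apply H2, YZ, Hp | exact H3]].
Qed.

Lemma null2_no_open (U Z : R * R -> Prop) p :
  open U -> U p -> (forall q, U q -> Z q) -> ~ null2 Z.
Proof.
  destruct p as [t x]; intros oU Up UZ HZ.
  destruct (open_prod_eps U t x oU Up) as [d [d0 Hd]].
  apply (rectangle_not_null (t - d / 2) (t + d / 2) (x - d / 2) (x + d / 2)); try lra.
  apply null2_subset with Z; [|exact HZ].
  intros [s y] [Hs Hy]; apply UZ, Hd; simpl in *; apply Rabs_def1; lra.
Qed.

(** * Periodic orbits and components of the zero set *)

Lemma sol_clamped h phi : sol h in01 phi ->
  sol h in01 (fun t => phi (clamp 0 1 t)).
Proof.
  intros H; split; [apply H|split; [auto|]].
  intros t Ht; rewrite clamp_id by exact Ht.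
  apply has_deriv_within_ext with phi; [|exact Ht|apply H; exact Ht].
  intros s Hs; rewrite clamp_id by exact Hs; reflexivity.
Qed.

(** The flow between two solutions, made total by clamping time and initial value. Joint continuity
    combines continuity in time with a Lipschitz bound in the initial value that is uniform in
    time. *)
Lemma flow_between A B C u v :
  continuous01 A -> continuous01 B -> continuous01 C ->
  sol (abel A B C) in01 u -> sol (abel A B C) in01 v -> u 0 <= v 0 ->
  exists G : R -> R -> R,
    (forall p : R * R, continuous (fun q : R * R => G (fst q) (snd q)) p) /\
    forall y, u 0 <= y <= v 0 -> sol (abel A B C) in01 (fun t => G t y) /\ G 0 y = y.
Proof.
  intros HA HB HC Hu Hv uv.
  assert (I0 : in01 0) by (split; lra).
  assert (ex : forall y, exists z, sol (abel A B C) in01 z /\ z 0 = clamp (u 0) (v 0) y).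
  { intros y; apply (sol_exists_between A B C u v); auto. apply clamp_in; exact uv. }
  set (phi := fun y => proj1_sig (constructive_indefinite_description _ (ex y))).
  assert (phi_sol : forall y, sol (abel A B C) in01 (phi y)).
  { intros y; unfold phi.
    destruct (constructive_indefinite_description _ (ex y)) as [z []]; assumption. }
  assert (phi_0 : forall y, phi y 0 = clamp (u 0) (v 0) y).
  { intros y; unfold phi.
    destruct (constructive_indefinite_description _ (ex y)) as [z []]; assumption. }
  destruct (sol_bounded _ u Hu) as [M [M0 HM]].
  destruct (sol_bounded _ v Hv) as [N [N0 HN]].
  assert (bd : forall y t, in01 t -> Rabs (phi y t) <= M + N).
  { intros y t Ht.
    assert (K := clamp_in (u 0) (v 0) y uv). rewrite <- phi_0 in K.
    assert (K1 : u t <= phi y t) by (apply (sol_order_le A B C); auto; apply K).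
    assert (K2 : phi y t <= v t) by (apply (sol_order_le A B C); auto; apply K).
    specialize (HM t Ht); specialize (HN t Ht).
    apply Rabs_le_between in HM; apply Rabs_le_between in HN.
    apply Rabs_le_between; lra. }
  destruct (abel_quot_bound A B C (M + N) HA HB HC ltac:(lra)) as [L [L0 HL]].
  assert (lip : forall y y' t, in01 t ->
     Rabs (phi y t - phi y' t) <= exp L * Rabs (y - y')).
  { intros y y' t Ht. assert (Ht' := Ht); unfold in01 in Ht'.
    destruct (sol_diff A B C 0 t (phi y') (phi y)) as [k [Hk kb]];
      try lra; try assumption; try (apply sol_restrict with in01; auto).
    rewrite Hk, Rabs_mult, (Rabs_pos_eq (exp k)) by (left; apply exp_pos).
    rewrite Rmult_comm; apply Rmult_le_compat; try apply Rabs_pos; [left; apply exp_pos| |].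
    (* Comparing with [g = 0] in [sol_diff] bounds [k] itself. *)
    - assert (K : Rabs (k - RInt (fun _ => 0) 0 t) <= (t - 0) * L).
      { apply kb; [intros; apply continuous_const|].
        intros s Hs; rewrite Rminus_0_r. assert (in01 s) by (split; lra).
        assert (E : abel_quot A B C s (phi y' s) (phi y s) =
          abel_quot (ext01 A) (ext01 B) (ext01 C) s (phi y' s) (phi y s))
          by (unfold abel_quot; rewrite !ext01_id by assumption; reflexivity).
        rewrite E; apply HL; apply bd; assumption. }
      rewrite RInt_const in K. unfold scal in K; simpl in K; unfold mult in K; simpl in K.
      rewrite Rmult_0_r, !Rminus_0_r in K. apply Rabs_le_between in K.
      destruct (Rle_lt_or_eq_dec k L) as [l|E]; [nra| |rewrite E; lra].
      left; apply exp_increasing; exact l.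
    - rewrite !phi_0; apply clamp_lip. }
  exists (fun t y => phi y (clamp 0 1 t)); split.
  - intros [t y].
    apply filterlim_locally; intros eps.
    assert (ct := sol_continuous01 _ _ (phi_sol y) t).
    destruct (proj1 (continuous_eps _ _) ct (eps / 2)) as [d [d0 Hd]].
    { destruct eps; simpl; lra. }
    assert (E0 := exp_pos L).
    assert (e0 : 0 < eps / 2 / exp L)
      by (apply Rdiv_lt_0_compat; [destruct eps; simpl; lra | exact E0]).
    exists (mkposreal _ (Rmin_pos _ _ d0 e0)); intros [s z] [Hs Hz]; simpl in *.
    change (Rabs (s - t) < Rmin d (eps / 2 / exp L)) in Hs.
    change (Rabs (z - y) < Rmin d (eps / 2 / exp L)) in Hz.
    assert (Hs' : Rabs (s - t) < d) by (eapply Rlt_le_trans; [exact Hs | apply Rmin_l]).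
    assert (Hz' : Rabs (z - y) < eps / 2 / exp L)
      by (eapply Rlt_le_trans; [exact Hz | apply Rmin_r]).
    specialize (Hd s Hs'). unfold ext01 in Hd.
    assert (K := lip z y (clamp 0 1 s) ltac:(apply clamp_in; lra)).
    assert (exp L * Rabs (z - y) < eps / 2).
    { apply Rmult_lt_compat_l with (r := exp L) in Hz'; [|exact E0].
      replace (exp L * (eps / 2 / exp L)) with (eps / 2) in Hz' by (field; lra). exact Hz'. }
    change (Rabs (phi z (clamp 0 1 s) - phi y (clamp 0 1 t)) < eps).
    replace (phi z (clamp 0 1 s) - phi y (clamp 0 1 t)) with
      ((phi z (clamp 0 1 s) - phi y (clamp 0 1 s)) +
       (phi y (clamp 0 1 s) - phi y (clamp 0 1 t))) by ring.
    eapply Rle_lt_trans; [apply Rabs_triang|]. lra.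
  - intros y Hy; split; [apply sol_clamped, phi_sol|].
    rewrite clamp_id by exact I0. rewrite phi_0; apply clamp_id; exact Hy.
Qed.

Lemma mult_neg_cases a b : a * b < 0 -> a < 0 /\ 0 < b \/ 0 < a /\ b < 0.
Proof.
  intros H. destruct (Rtotal_order a 0) as [l|[E|l]].
  - left; split; [exact l|]. apply Rnot_le_lt; intros K; nra.
  - rewrite E in H; lra.
  - right; split; [exact l|]. apply Rnot_le_lt; intros K; nra.
Qed.

(** Upward crossings at both ends make [k] positive just after [a] and negative just before [b], so
    some zero in between is reached from positive values. *)
Lemma not_all_zeros_increasing (k : R -> R) a b :
  a < b -> (forall x, continuous k x) -> k a = 0 -> k b = 0 ->
  ~ (forall y, a <= y <= b -> k y = 0 -> exists d, 0 < d /\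
       forall x, a <= x <= b -> 0 < Rabs (x - y) < d -> 0 < k x * (x - y)).
Proof.
  intros ab ck ka kb H.
  destruct (H a ltac:(lra) ka) as [d1 [d10 H1]].
  destruct (H b ltac:(lra) kb) as [d2 [d20 H2]].
  set (m := Rmin (Rmin d1 d2) (b - a) / 3).
  assert (m0 : 0 < Rmin (Rmin d1 d2) (b - a)) by (repeat apply Rmin_pos; lra).
  assert (m1 := Rmin_l (Rmin d1 d2) (b - a)). assert (m2 := Rmin_r (Rmin d1 d2) (b - a)).
  assert (m3 := Rmin_l d1 d2). assert (m4 := Rmin_r d1 d2).
  assert (K1 : 0 < k (a + m)).
  { assert (K : 0 < k (a + m) * (a + m - a)).
    { apply H1; [unfold m; lra|]. rewrite Rabs_pos_eq; unfold m; lra. }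
    replace (a + m - a) with m in K by ring. assert (0 < m) by (unfold m; lra). nra. }
  assert (K2 : k (b - m) < 0).
  { assert (K : 0 < k (b - m) * (b - m - b)).
    { apply H2; [unfold m; lra|].
      rewrite Rabs_left; unfold m; lra. }
    replace (b - m - b) with (- m) in K by ring. assert (0 < m) by (unfold m; lra). nra. }
  destruct (first_zero (fun x => - k x) (a + m) (b - m)) as [c [Hc [kc Hneg]]].
  { unfold m; lra. } { intros x; apply (continuous_opp k), ck. } { lra. }
  assert (kc' : k c = 0) by lra.
  assert (ac : a + m < c).
  { destruct (Rle_lt_or_eq_dec (a + m) c) as [l|E]; [lra|exact l|].
    rewrite E in K1; lra. }
  destruct (H c ltac:(unfold m in *; lra) kc') as [d [d0 Hd]].
  assert (n0 : 0 < Rmin d (c - (a + m))) by (apply Rmin_pos; lra).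
  assert (n1 := Rmin_l d (c - (a + m))). assert (n2 := Rmin_r d (c - (a + m))).
  set (n := Rmin d (c - (a + m))) in *.
  assert (P : 0 < k (c - n / 2) * (c - n / 2 - c)).
  { apply Hd; [unfold m in *; lra|]. rewrite Rabs_left; lra. }
  specialize (Hneg (c - n / 2) ltac:(lra)). nra.
Qed.

Lemma Mw_zero_on_open f h w (W : R * R -> Prop) t x :
  open W -> W (t, x) -> (forall p, W p -> f (fst p) (snd p) = 0) -> Mw h f w t x = 0.
Proof.
  intros oW Wp H.
  destruct (open_prod_eps W t x oW Wp) as [d [d0 Hd]].
  unfold Mw. replace (dt f t x) with 0; [replace (dx f t x) with 0|].
  - rewrite (H (t, x) Wp : f t x = 0); ring.
  - symmetry; unfold dx. rewrite (Derive_ext_loc _ (fun _ => 0)); [apply Derive_const|].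
    exists (mkposreal d d0); intros y Hy; apply (H (t, y)), Hd; [|exact Hy].
    rewrite Rminus_diag, Rabs_R0; exact d0.
  - symmetry; unfold dt. rewrite (Derive_ext_loc _ (fun _ => 0)); [apply Derive_const|].
    exists (mkposreal d d0); intros s Hs; apply (H (s, x)), Hd; [exact Hs|].
    rewrite Rminus_diag, Rabs_R0; exact d0.
Qed.

Definition zero_set (f : R -> R -> R) (p : R * R) : Prop :=
  in01 (fst p) /\ f (fst p) (snd p) = 0.

Section Orbits.

Context (A B C : R -> R) (f : R -> R -> R) (w : R).
Context (HA : continuous01 A) (HB : continuous01 B) (HC : continuous01 C)
  (Hf : C1_2d f) (Hper : periodic1 f)
  (M_nneg : forall t x, in01 t -> 0 <= Mw (abel A B C) f w t x)
  (M_null : null2 (fun p => in01 (fst p) /\ Mw (abel A B C) f w (fst p) (snd p) = 0))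
  (M_zeros : forall P, invariant (abel A B C) P ->
     (forall p, P p -> Mw (abel A B C) f w (fst p) (snd p) = 0) ->
     forall p, P p -> f (fst p) (snd p) = 0).

(** The sign [s] selects a side of [u], so that both sides share one proof below. *)
Lemma sol_order_signed s u v t :
  s = 1 \/ s = -1 -> sol (abel A B C) in01 u -> sol (abel A B C) in01 v -> in01 t ->
  (0 < s * (v 0 - u 0) <-> 0 < s * (v t - u t)).
Proof.
  intros Hs Hu Hv Ht.
  assert (K1 := sol_order A B C u v t HA HB HC Hu Hv Ht).
  assert (K2 := sol_order A B C v u t HA HB HC Hv Hu Ht).
  destruct Hs as [-> | ->]; split; intros K.
  - assert (u t < v t) by (apply K1; lra); lra.
  - assert (u 0 < v 0) by (apply K1; lra); lra.
  - assert (v t < u t) by (apply K2; lra); lra.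
  - assert (v 0 < u 0) by (apply K2; lra); lra.
Qed.

(* If every arc close to [u] met [{f = 0}], then [f 0 y <= 0 <= f 0 (Pi y)] for
   [y] near [u 0], hence [f 0 = 0] there and [f = 0] on an open set. *)
Lemma arc_avoiding_zeros s u del :
  s = 1 \/ s = -1 -> sol (abel A B C) in01 u -> u 0 = u 1 ->
  (forall t, in01 t -> f t (u t) = 0) -> 0 < del ->
  exists z, sol (abel A B C) in01 z /\ 0 < s * (z 0 - u 0) < del /\
    forall t, in01 t -> f t (z t) <> 0.
Proof.
  intros Hs Hu Eu Zu del0; apply NNPP; intros N.
  assert (I0 : in01 0) by (split; lra). assert (I1 : in01 1) by (split; lra).
  assert (ss : s * s = 1) by (destruct Hs as [-> | ->]; ring).
  assert (meets : forall z, sol (abel A B C) in01 z -> 0 < s * (z 0 - u 0) < del ->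
     f 0 (z 0) <= 0 <= f 0 (z 1)).
  { intros z Hz Hz0.
    assert (X : exists t, in01 t /\ f t (z t) = 0).
    { apply NNPP; intros N'; apply N; exists z; split; [exact Hz|split; [exact Hz0|]].
      intros t Ht E; apply N'; exists t; auto. }
    destruct X as [t [Ht E]]; unfold in01 in Ht. split.
    - apply Rnot_lt_le; intros P.
      assert (0 < f t (z t)); [|lra].
      apply (f_pos_forward A B C f w HA HB HC Hf M_nneg z 0 t); try lra; assumption.
    - rewrite <- (f_time_periodic f Hper (z 1)).
      apply (f_nneg_forward A B C f w HA HB HC Hf M_nneg z t 1); try lra; assumption. }
  destruct (sol_exists_near A B C u HA HB HC Hu) as [dn [K [dn0 [K0 [_ near]]]]].
  set (d := Rmin dn del / 2).
  assert (d0 : 0 < d).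
  { unfold d; assert (0 < Rmin dn del) by (apply Rmin_pos; assumption); lra. }
  assert (dd : d < dn /\ d < del).
  { assert (L1 := Rmin_l dn del). assert (L2 := Rmin_r dn del). unfold d in *; lra. }
  destruct (near (u 0 - d)) as [v1 [Hv1 [v10 _]]]; [apply Rabs_def1; lra|].
  destruct (near (u 0 + d)) as [v2 [Hv2 [v20 _]]]; [apply Rabs_def1; lra|].
  destruct (flow_between A B C v1 v2 HA HB HC Hv1 Hv2 ltac:(lra)) as [G [cG HG]].
  rewrite v10, v20 in HG.
  assert (HGs : forall r, 0 <= r <= d ->
     sol (abel A B C) in01 (fun t => G t (u 0 + s * r)) /\ G 0 (u 0 + s * r) = u 0 + s * r).
  { intros r Hr; apply HG; destruct Hs as [-> | ->]; lra. }
  assert (cr : forall t r, continuous (fun r => s * (G t (u 0 + s * r) - u t)) r).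
  { intros t r; apply continuous_Rmult; [apply continuous_const|].
    apply continuous_Rminus; [|apply continuous_const].
    apply (continuous_comp_2 (fun _ => t) (fun r => u 0 + s * r) G);
      [apply continuous_const | | apply (cG (t, u 0 + s * r))].
    apply continuous_Rplus; [apply continuous_const|].
    apply continuous_Rmult; [apply continuous_const | apply continuous_id]. }
  assert (base : forall t, in01 t -> s * (G t (u 0 + s * 0) - u t) = 0).
  { intros t Ht; destruct (HGs 0 ltac:(lra)) as [S0 S00].
    rewrite (sol_unique_at A B C in01 u (fun t => G t (u 0 + s * 0)) 0 t);
      try assumption; [ring|]. rewrite S00; ring. }
  assert (above : forall t r, in01 t -> 0 < r <= d -> 0 < s * (G t (u 0 + s * r) - u t)).
  { intros t r Ht Hr; destruct (HGs r ltac:(lra)) as [Sr S0].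
    apply (sol_order_signed s u (fun t => G t (u 0 + s * r)) t Hs Hu Sr Ht).
    rewrite S0. replace (s * (u 0 + s * r - u 0)) with (s * s * r) by ring.
    rewrite ss; lra. }
  (* An arc starting at distance [r] from the orbit returns at distance [e r]. *)
  set (e := fun r => s * (G 1 (u 0 + s * r) - u 1)).
  assert (eE : forall r, G 1 (u 0 + s * r) = u 0 + s * e r).
  { intros r; unfold e. rewrite <- Rmult_assoc, ss, Eu; ring. }
  assert (arc : forall r, 0 < r <= d -> f 0 (u 0 + s * r) <= 0 <= f 0 (u 0 + s * e r)).
  { intros r Hr; destruct (HGs r ltac:(lra)) as [Sr S0].
    rewrite <- eE. rewrite <- S0 at 1. apply (meets _ Sr). rewrite S0.
    replace (s * (u 0 + s * r - u 0)) with (s * s * r) by ring. rewrite ss; lra. }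
  (* Each distance up to [mu] is both a starting distance and, by the intermediate value theorem, a
     return distance, so [arc] gives both inequalities there. *)
  set (mu := Rmin (e d) d).
  assert (mu0 : 0 < mu) by (apply Rmin_pos; [apply above; auto; lra | exact d0]).
  assert (mu1 : mu <= e d) by apply Rmin_l.
  assert (mu2 : mu <= d) by apply Rmin_r.
  assert (F0 : forall r, 0 < r <= mu -> f 0 (u 0 + s * r) = 0).
  { intros r Hr; apply Rle_antisym; [apply (arc r ltac:(lra))|].
    destruct (IVT_continuous e 0 d r) as [r' [Hr' E]]; [lra | apply cr | |].
    { left; unfold e at 1; rewrite (base 1 I1); lra. }
    destruct (Req_dec r' 0) as [Z|Z].
    { unfold e in E; rewrite Z, (base 1 I1) in E; lra. }
    rewrite <- E; apply arc; lra. }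
  (* For [r <= r3] the return distance is also below [mu]: [f] vanishes at both ends of the arc,
     hence along it. *)
  destruct (proj1 (continuous_eps e 0) (cr 1 0) mu mu0) as [d3 [d30 Hd3]].
  set (r3 := Rmin mu (d3 / 2)).
  assert (r30 : 0 < r3) by (apply Rmin_pos; lra).
  assert (r31 : r3 <= mu) by apply Rmin_l.
  assert (r32 : r3 <= d3 / 2) by apply Rmin_r.
  assert (Zr : forall r t, 0 < r <= r3 -> in01 t -> f t (G t (u 0 + s * r)) = 0).
  { intros r t Hr Ht; destruct (HGs r ltac:(lra)) as [Sr S0].
    apply (f_zero_between A B C f w HA HB HC Hf M_nneg (fun t => G t (u 0 + s * r)));
      try assumption.
    - rewrite S0; apply F0; lra.
    - rewrite (f_time_periodic f Hper), eE; apply F0. split.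
      + apply above; auto; lra.
      + specialize (Hd3 r). rewrite Rminus_0_r, Rabs_pos_eq in Hd3 by lra.
        specialize (Hd3 ltac:(lra)). unfold e at 2 in Hd3. rewrite (base 1 I1) in Hd3.
        rewrite Rminus_0_r in Hd3. apply Rabs_lt_between in Hd3; lra. }
  (* Open region between [u] and the arc from [u 0 + s * r3]; the arcs with smaller [r] sweep it. *)
  set (W := fun p : R * R => (0 < fst p /\ fst p < 1) /\
     (0 < s * (snd p - ext01 u (fst p)) /\ 0 < s * (G (fst p) (u 0 + s * r3) - snd p))).
  assert (cu : forall p : R * R, continuous (fun p : R * R => ext01 u (fst p)) p).
  { intros p; apply continuous_comp; [apply continuous_fst|].
    apply (sol_continuous01 _ _ Hu). }
  assert (oW : open W).
  { apply open_and; apply open_and.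
    - apply (open_comp fst (fun x => 0 < x)); [intros; apply continuous_fst | apply open_gt].
    - apply (open_comp fst (fun x => x < 1)); [intros; apply continuous_fst | apply open_lt].
    - apply (open_comp (fun p : R * R => s * (snd p - ext01 u (fst p))) (fun x => 0 < x));
        [|apply open_gt].
      intros p _. apply (continuous_scal_r s (fun p : R * R => snd p - ext01 u (fst p))).
      apply (continuous_minus snd (fun p : R * R => ext01 u (fst p)));
        [apply continuous_snd | apply cu].
    - apply (open_comp (fun p : R * R => s * (G (fst p) (u 0 + s * r3) - snd p))
         (fun x => 0 < x)); [|apply open_gt].
      intros p _.
      apply (continuous_scal_r s (fun p : R * R => G (fst p) (u 0 + s * r3) - snd p)).
      apply (continuous_minus (fun p : R * R => G (fst p) (u 0 + s * r3)) snd);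
        [|apply continuous_snd].
      apply (continuous_comp_2 fst (fun _ : R * R => u 0 + s * r3) G);
        [apply continuous_fst | apply continuous_const | apply (cG (fst p, u 0 + s * r3))]. }
  assert (ZW : forall p, W p -> f (fst p) (snd p) = 0).
  { intros [t x] [Ht [H1 H2]]; simpl in *.
    assert (It : in01 t) by (split; lra). rewrite ext01_id in H1 by exact It.
    destruct (IVT_continuous (fun r => s * (G t (u 0 + s * r) - u t)) 0 r3 (s * (x - u t)))
      as [r [Hr E]]; [lra | apply cr | left; rewrite (base t It); lra|].
    destruct (Req_dec r 0) as [Z|Z].
    { rewrite Z, (base t It) in E; lra. }
    replace x with (G t (u 0 + s * r)); [apply Zr; [lra | exact It]|].
    destruct Hs as [-> | ->]; lra. }
  assert (Ih : in01 (1 / 2)) by (split; lra).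
  apply (null2_no_open W _ (1 / 2, (u (1 / 2) + G (1 / 2) (u 0 + s * r3)) / 2) oW) in M_null;
    [exact M_null| |].
  - assert (P := above (1 / 2) r3 Ih ltac:(lra)).
    unfold W; simpl; rewrite ext01_id by exact Ih. destruct Hs as [-> | ->]; lra.
  - intros [t x] Wp; split; [destruct Wp; simpl in *; split; lra|].
    apply (Mw_zero_on_open f _ w W t x oW Wp ZW).
Qed.

(** Between the orbit and any other point of the strip runs an arc avoiding [{f = 0}], and a
    connected zero set cannot cross it. *)
Lemma zero_orbit_comp u : sol (abel A B C) in01 u -> u 0 = u 1 ->
  (forall t, in01 t -> f t (u t) = 0) ->
  forall p, Defs.comp (zero_set f) (0, u 0) p <-> graph u p.
Proof.
  intros Hu Eu Zu [t x]; split.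
  - intros [K [cK [KZ [K0 Kp]]]].
    assert (Ht : in01 t) by apply (KZ _ Kp).
    split; [exact Ht|]; simpl; apply NNPP; intros ne.
    destruct (sol_exists_near A B C u HA HB HC Hu) as [d [L [d0 [L0 [_ near]]]]].
    assert (X : forall s, s = 1 \/ s = -1 -> 0 < s * (x - u t) ->
       exists z, sol (abel A B C) in01 z /\ (forall t, in01 t -> f t (z t) <> 0) /\
         0 < s * (z 0 - u 0) /\ 0 < s * (x - z t)).
    { intros s Hs P.
      (* Solutions separate from [u] by at most the factor [L], so this start keeps the arc between
         [u t] and [x] at time [t]. *)
      destruct (arc_avoiding_zeros s u (Rmin d (s * (x - u t) / L)) Hs Hu Eu Zu)
        as [z [Hz [Hz0 Hzf]]].
      { apply Rmin_pos; [exact d0 | apply Rdiv_lt_0_compat; assumption]. }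
      exists z; split; [exact Hz|split; [exact Hzf|split; [apply Hz0|]]].
      assert (m1 := Rmin_l d (s * (x - u t) / L)).
      assert (m2 := Rmin_r d (s * (x - u t) / L)).
      assert (Ez : Rabs (z 0 - u 0) = s * (z 0 - u 0)).
      { destruct Hs as [-> | ->]; [rewrite Rabs_pos_eq | rewrite Rabs_left]; lra. }
      destruct (near (z 0)) as [z' [Hz' [z'0 Hn]]]; [lra|].
      specialize (Hn t Ht).
      rewrite (sol_unique_at A B C in01 z z' 0 t) in Hn; try assumption;
        [|split; lra].
      rewrite Ez in Hn.
      assert (L * (s * (z 0 - u 0)) < s * (x - u t)).
      { apply Rlt_le_trans with (L * (s * (x - u t) / L)); [|right; field; lra].
        apply Rmult_lt_compat_l; lra. }
      apply Rabs_le_between in Hn. destruct Hs as [-> | ->]; lra. }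
    assert (side : forall z, sol (abel A B C) in01 z ->
       (forall t, in01 t -> f t (z t) <> 0) ->
       (exists p, K p /\ snd p < z (fst p)) -> forall p, K p -> snd p < z (fst p)).
    { intros z Hz Hzf. apply connected2_one_side; [exact cK | apply (sol_continuous01 _ _ Hz) | |].
      - intros p Hp; apply (KZ p Hp).
      - intros p Hp E; destruct (KZ p Hp) as [Ip Fp]. apply (Hzf (fst p) Ip).
        rewrite <- E; exact Fp. }
    destruct (Rdichotomy _ _ ne) as [l|l].
    + destruct (X (-1)) as [z [Hz [Hzf [P1 P2]]]]; [auto | lra|].
      assert (Q := side z Hz Hzf ltac:(exists (t, x); simpl; split; [exact Kp | lra]) _ K0).
      simpl in Q; lra.
    + destruct (X 1) as [z [Hz [Hzf [P1 P2]]]]; [auto | lra|].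
      assert (Q := side z Hz Hzf ltac:(exists (0, u 0); simpl; split; [exact K0 | lra]) _ Kp).
      simpl in Q; lra.
  - intros Hp; exists (graph u); split; [|split; [|split]].
    + apply graph_connected, (sol_continuous01 _ _ Hu).
    + intros [r y] [Hr E]; simpl in *; subst y; split; [exact Hr | apply Zu; exact Hr].
    + split; simpl; [split; lra | reflexivity].
    + exact Hp.
Qed.

(** One point between the graphs suffices: if [f] does not vanish on them, [connected2_one_side]
    keeps the whole component there. *)
Definition separating_component (u v : R -> R) : Prop :=
  exists p, zero_set f p /\ joins01 (Defs.comp (zero_set f) p) /\
    u (fst p) < snd p < v (fst p).

Lemma separated_of_opposite_signs u v :
  sol (abel A B C) in01 u -> u 0 = u 1 -> sol (abel A B C) in01 v -> v 0 = v 1 ->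
  u 0 < v 0 -> f 0 (u 0) * f 0 (v 0) < 0 -> separating_component u v.
Proof.
  intros Hu Eu Hv Ev uv opp.
  assert (I0 : in01 0) by (split; lra).
  destruct (flow_between A B C u v HA HB HC Hu Hv ltac:(lra)) as [G [cG HG]].
  assert (Gu : forall t, in01 t -> G t (u 0) = u t).
  { intros t Ht; destruct (HG (u 0) ltac:(lra)) as [S S0].
    apply (sol_unique_at A B C in01 u (fun t => G t (u 0)) 0 t); assumption. }
  assert (Gv : forall t, in01 t -> G t (v 0) = v t).
  { intros t Ht; destruct (HG (v 0) ltac:(lra)) as [S S0].
    apply (sol_unique_at A B C in01 v (fun t => G t (v 0)) 0 t); assumption. }
  assert (su := fun t Ht =>
    periodic_f_sign A B C f w HA HB HC Hf Hper M_nneg u Hu Eu t Ht).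
  assert (sv := fun t Ht =>
    periodic_f_sign A B C f w HA HB HC Hf Hper M_nneg v Hv Ev t Ht).
  destruct (crossing_band (fun t y => f t (G t y)) (u 0) (v 0))
    as [K [cK [HK [[p [Kp p0]] [q [Kq q1]]]]]].
  - exact uv.
  - intros x. apply (continuous_comp_2 fst (fun q : R * R => G (fst q) (snd q)) f);
      [apply continuous_fst | apply cG | apply C1_2d_continuous; exact Hf].
  - intros x s t Hx Hs Ht.
    apply (f_nneg_forward A B C f w HA HB HC Hf M_nneg (fun t => G t x)); try assumption.
    apply HG; exact Hx.
  - intros x s t Hx Hs Ht.
    apply (f_pos_forward A B C f w HA HB HC Hf M_nneg (fun t => G t x)); try assumption.
    apply HG; exact Hx.
  - assert (D : f 0 (u 0) < 0 /\ 0 < f 0 (v 0) \/ 0 < f 0 (u 0) /\ f 0 (v 0) < 0).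
    { apply mult_neg_cases; exact opp. }
    destruct D as [[D1 D2]|[D1 D2]]; [left|right]; (split; intros t Ht);
      rewrite ?Gu, ?Gv by exact Ht; first [apply (su t Ht) | apply (sv t Ht)]; assumption.
  (* Back from flow coordinates to the strip; times are unchanged, so the image still joins 0 to
     1. *)
  - set (psi := fun q : R * R => (fst q, G (fst q) (snd q))).
    set (J := fun q => exists p, K p /\ q = psi p).
    assert (cJ : connected2 J).
    { apply connected2_image; [|exact cK].
      intros x; apply continuous_pair; [apply continuous_fst | apply cG]. }
    assert (JZ : forall q, J q -> zero_set f q).
    { intros r [x [Kx ->]]; destruct (HK x Kx) as [X1 [_ X3]]; split; assumption. }
    assert (Jp : J (psi p)) by (exists p; auto).
    exists (psi p); split; [apply JZ, Jp|split; [split|]].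
    + exists (psi p); split; [exists J; auto | exact p0].
    + exists (psi q); split; [|exact q1].
      exists J; split; [exact cJ|split; [exact JZ|split; [exact Jp|]]]; exists q; auto.
    + destruct (HK p Kp) as [Ip [yp zp]]; simpl.
      destruct (HG (snd p) yp) as [S S0].
      assert (L1 : u (fst p) <= G (fst p) (snd p)).
      { apply (sol_order_le A B C u (fun t => G t (snd p)) (fst p)); try assumption.
        rewrite S0; apply yp. }
      assert (L2 : G (fst p) (snd p) <= v (fst p)).
      { apply (sol_order_le A B C (fun t => G t (snd p)) v (fst p)); try assumption.
        rewrite S0; apply yp. }
      destruct (su (fst p) Ip) as [_ [su1 su2]]. destruct (sv (fst p) Ip) as [_ [sv1 sv2]].
      assert (N1 : f (fst p) (u (fst p)) <> 0).
      { destruct (mult_neg_cases _ _ opp) as [[Y _]|[Y _]];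
          [specialize (su2 Y) | specialize (su1 Y)]; lra. }
      assert (N2 : f (fst p) (v (fst p)) <> 0).
      { destruct (mult_neg_cases _ _ opp) as [[_ Y]|[_ Y]];
          [specialize (sv1 Y) | specialize (sv2 Y)]; lra. }
      split.
      * destruct (Rle_lt_or_eq_dec _ _ L1) as [l|E]; [exact l|].
        rewrite <- E in zp; contradiction.
      * destruct (Rle_lt_or_eq_dec _ _ L2) as [l|E]; [exact l|].
        rewrite E in zp; contradiction.
Qed.

(* Otherwise all zeros of the displacement [Pi y - y] on [[u 0, v 0]] would be
   crossed in the same direction. *)
Lemma orbit_of_other_sign_between u v :
  sol (abel A B C) in01 u -> u 0 = u 1 -> sol (abel A B C) in01 v -> v 0 = v 1 ->
  u 0 < v 0 -> 0 < f 0 (u 0) * f 0 (v 0) ->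
  exists z, sol (abel A B C) in01 z /\ z 0 = z 1 /\ u 0 < z 0 < v 0 /\
    f 0 (u 0) * f 0 (z 0) <= 0.
Proof.
  intros Hu Eu Hv Ev uv same; apply NNPP; intros N.
  assert (I0 : in01 0) by (split; lra). assert (I1 : in01 1) by (split; lra).
  destruct (flow_between A B C u v HA HB HC Hu Hv ltac:(lra)) as [G [cG HG]].
  assert (Gu : G 1 (u 0) = u 1).
  { destruct (HG (u 0) ltac:(lra)) as [S S0].
    apply (sol_unique_at A B C in01 u (fun t => G t (u 0)) 0 1); assumption. }
  assert (Gv : G 1 (v 0) = v 1).
  { destruct (HG (v 0) ltac:(lra)) as [S S0].
    apply (sol_unique_at A B C in01 v (fun t => G t (v 0)) 0 1); assumption. }
  assert (F0 : f 0 (u 0) <> 0) by (intros E; rewrite E in same; lra).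
  (* At a zero [y] where [f 0 y] has the sign of [f 0 (u 0)], [periodic_nonzero] gives the factor
     [f 0 (u 0) * w] the sign of [Q], which is that of [exp Q - 1]: [k] crosses 0 upwards. *)
  set (k := fun y => f 0 (u 0) * w * (G 1 y - y)).
  assert (w0 : w <> 0).
  { intros E; destruct (periodic_nonzero A B C f w HA HB HC Hf Hper M_nneg M_zeros u Hu Eu)
      as [_ P]; [exists 0; auto|]. rewrite E in P; lra. }
  assert (c0 : f 0 (u 0) * w <> 0) by (apply Rmult_integral_contrapositive; auto).
  apply (not_all_zeros_increasing k (u 0) (v 0) uv).
  - intros y; apply continuous_Rmult; [apply continuous_const|].
    apply continuous_Rminus; [|apply continuous_id].
    apply (continuous_comp_2 (fun _ => 1) (fun y => y) G);
      [apply continuous_const | apply continuous_id | apply (cG (1, y))].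
  - unfold k; rewrite Gu, Eu; ring.
  - unfold k; rewrite Gv, Ev; ring.
  - intros y Hy ky.
    assert (Py : G 1 y = y).
    { unfold k in ky; apply Rmult_integral in ky; destruct ky; [contradiction | lra]. }
    destruct (HG y Hy) as [S S0]. set (z := fun t => G t y) in *.
    assert (Ez : z 0 = z 1) by (unfold z; rewrite S0, Py; reflexivity).
    assert (z0 : z 0 = y) by exact S0.
    assert (same' : 0 < f 0 (u 0) * f 0 y).
    { destruct (Req_dec y (u 0)) as [E1|E1]; [rewrite E1; nra|].
      destruct (Req_dec y (v 0)) as [E2|E2]; [rewrite E2; exact same|].
      apply Rnot_le_lt; intros K; apply N; exists z; split; [exact S|].
      rewrite <- Ez, z0; split; [reflexivity|split; [lra | exact K]]. }
    destruct (periodic_nonzero A B C f w HA HB HC Hf Hper M_nneg M_zeros z S Ez) as [_ P].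
    { exists 0; split; [exact I0|]. rewrite z0; intros E; rewrite E in same'; lra. }
    rewrite z0 in P.
    assert (D := poincare_deriv_exp A B C z HA HB HC S).
    set (Q := RInt (slope A B C z) 0 1) in *. rewrite z0 in D.
    assert (cQ : 0 < f 0 (u 0) * w * Q).
    { assert (P' : 0 < (f 0 (u 0) * f 0 y) * (f 0 y * (w * Q)))
        by (apply Rmult_lt_0_compat; assumption).
      apply Rmult_lt_reg_l with (f 0 y * f 0 y); [|].
      - assert (f 0 y <> 0) by (intros E; rewrite E in same'; lra).
        destruct (Rdichotomy _ _ H); nra.
      - lra. }
    assert (E0 := exp_0).
    assert (ex1 : exp Q <> 1).
    { intros E; rewrite <- exp_0 in E; apply exp_inv in E; rewrite E in cQ; lra. }
    destruct D as [_ D].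
    (* This tolerance keeps the difference quotient on the same side of 1 as [exp Q]. *)
    destruct (D (Rabs (exp Q - 1))) as [del [del0 Hdel]].
    { apply Rabs_pos_lt; lra. }
    exists del; split; [exact del0|]; intros x Hx Hxy.
    specialize (Hdel x (G 1 x) (G 1 y) Hxy).
    assert (K : Rabs ((G 1 x - G 1 y) / (x - y) - exp Q) < Rabs (exp Q - 1)).
    { apply Hdel; [exists z; auto|].
      destruct (HG x Hx) as [Sx Sx0]; exists (fun t => G t x); auto. }
    rewrite Py in K.
    assert (xy : x <> y) by (intros E; rewrite E, Rminus_diag, Rabs_R0 in Hxy; lra).
    set (q := (G 1 x - y) / (x - y)) in K.
    assert (qE : G 1 x - x = (q - 1) * (x - y)) by (unfold q; field; lra).
    unfold k; rewrite qE.
    replace (f 0 (u 0) * w * ((q - 1) * (x - y)) * (x - y)) with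
      (f 0 (u 0) * w * (q - 1) * ((x - y) * (x - y))) by ring.
    apply Rmult_lt_0_compat; [|destruct (Rdichotomy _ _ xy); nra].
    set (c := f 0 (u 0) * w) in *.
    destruct (Rlt_le_dec Q 0) as [l|l].
    + assert (exp Q < exp 0) by (apply exp_increasing; exact l).
      rewrite (Rabs_left (exp Q - 1)) in K by lra. apply Rabs_lt_between in K. nra.
    + assert (Q <> 0) by (intros E; rewrite E in cQ; lra).
      assert (exp 0 < exp Q) by (apply exp_increasing; lra).
      rewrite (Rabs_pos_eq (exp Q - 1)) in K by lra. apply Rabs_lt_between in K. nra.
Qed.

Lemma zero_orbit_joins u : sol (abel A B C) in01 u -> u 0 = u 1 ->
  (forall t, in01 t -> f t (u t) = 0) -> joins01 (Defs.comp (zero_set f) (0, u 0)).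
Proof.
  intros Hu Eu Zu; split; [exists (0, u 0) | exists (1, u 1)]; split; try reflexivity;
    apply zero_orbit_comp; try assumption; split; simpl; try reflexivity; split; lra.
Qed.

Lemma nonzero_orbits_separated u v :
  sol (abel A B C) in01 u -> u 0 = u 1 -> sol (abel A B C) in01 v -> v 0 = v 1 ->
  u 0 < v 0 -> f 0 (u 0) <> 0 -> f 0 (v 0) <> 0 -> separating_component u v.
Proof.
  intros Hu Eu Hv Ev uv Fu Fv.
  assert (I0 : in01 0) by (split; lra).
  destruct (Rlt_le_dec (f 0 (u 0) * f 0 (v 0)) 0) as [l|l].
  { apply separated_of_opposite_signs; assumption. }
  destruct (orbit_of_other_sign_between u v Hu Eu Hv Ev uv) as [z [Hz [Ez [Hz0 Fz]]]].
  { destruct l as [l|l]; [exact l|].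
    symmetry in l; apply Rmult_integral in l; destruct l; contradiction. }
  destruct (Req_dec (f 0 (z 0)) 0) as [Z|Z].
  - exists (0, z 0); split; [split; assumption|split; [|exact Hz0]].
    apply zero_orbit_joins; try assumption.
    intros t Ht; apply (proj1 (periodic_f_sign A B C f w HA HB HC Hf Hper M_nneg z Hz Ez t Ht) Z).
  - destruct (separated_of_opposite_signs u z Hu Eu Hz Ez) as [p [Zp [Jp [p1 p2]]]].
    + lra.
    + destruct Fz as [Fz|Fz]; [exact Fz|].
      apply Rmult_integral in Fz; destruct Fz; contradiction.
    + exists p; split; [exact Zp|split; [exact Jp|split; [exact p1|]]].
      apply Rlt_trans with (z (fst p)); [exact p2|].
      apply (sol_order A B C z v (fst p)); try assumption; [apply Zp | lra].
Qed.

End Orbits.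

(** * Counting periodic orbits *)

(** The representative matched with [p] can be removed: a later point matched with it too would be
    connected to [p]. *)
Lemma pigeonhole_conn (Z : R * R -> Prop) (ps reps : list (R * R)) :
  ForallOrdPairs (fun p q => ~ conn Z p q) ps ->
  (forall p, In p ps -> exists r, In r reps /\ conn Z r p) ->
  (length ps <= length reps)%nat.
Proof.
  intros H; revert reps; induction H as [|p ps Hp H IH]; intros reps Hr; simpl; [lia|].
  destruct (Hr p (or_introl eq_refl)) as [r [Ir Cr]].
  destruct (in_split r reps Ir) as [l1 [l2 ->]].
  assert (K : (length ps <= length (l1 ++ l2))%nat).
  { apply IH; intros q Iq.
    destruct (Hr q (or_intror Iq)) as [r' [Ir' Cr']].
    exists r'; split; [|exact Cr'].
    apply in_app_or in Ir'; apply in_or_app.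
    destruct Ir' as [I|[E|I]]; [left; exact I| |right; exact I].
    exfalso; subst r'. rewrite Forall_forall in Hp. apply (Hp q Iq).
    apply conn_trans with r; [apply conn_sym; exact Cr | exact Cr']. }
  rewrite length_app in *; simpl; lia.
Qed.

Lemma list_extract_max (l : list R) : l <> nil ->
  exists x l', Permutation l (x :: l') /\ forall y, In y l' -> y <= x.
Proof.
  induction l as [|a l IH]; [congruence|intros _].
  destruct l as [|b l].
  - exists a, nil; split; [apply Permutation_refl | intros y []].
  - destruct IH as [x [l' [P Hx]]]; [discriminate|].
    destruct (Rle_dec a x) as [ax|ax].
    + exists x, (a :: l'); split.
      * eapply Permutation_trans; [apply perm_skip, P | apply perm_swap].
      * intros y [<-|Iy]; auto.
    + exists a, (x :: l'); split; [apply perm_skip, P|].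
      intros y [<-|Iy]; [lra|]. specialize (Hx y Iy); lra.
Qed.

Section Counting.

Context (A B C : R -> R) (f : R -> R -> R) (w : R).
Context (HA : continuous01 A) (HB : continuous01 B) (HC : continuous01 C)
  (Hf : C1_2d f) (Hper : periodic1 f)
  (M_nneg : forall t x, in01 t -> 0 <= Mw (abel A B C) f w t x)
  (M_null : null2 (fun p => in01 (fst p) /\ Mw (abel A B C) f w (fst p) (snd p) = 0))
  (M_zeros : forall P, invariant (abel A B C) P ->
     (forall p, P p -> Mw (abel A B C) f w (fst p) (snd p) = 0) ->
     forall p, P p -> f (fst p) (snd p) = 0).

Definition nonzero_ic (x : R) : Prop := periodic_ic (abel A B C) x /\ f 0 x <> 0.

Definition zero_ic (x : R) : Prop := periodic_ic (abel A B C) x /\ f 0 x = 0.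

Lemma split_ic (l : list R) : (forall x, In x l -> periodic_ic (abel A B C) x) ->
  exists l1 l2, Permutation l (l1 ++ l2) /\
    (forall x, In x l1 -> nonzero_ic x) /\ (forall x, In x l2 -> zero_ic x).
Proof.
  induction l as [|a l IH]; intros H.
  - exists nil, nil; split; [apply Permutation_refl|split; intros x []].
  - destruct IH as [l1 [l2 [P [H1 H2]]]]; [intros x Ix; apply H; right; exact Ix|].
    assert (Pa := H a (or_introl eq_refl)).
    destruct (Req_dec (f 0 a) 0) as [Z|Z].
    + exists l1, (a :: l2); split; [|split; [exact H1|]].
      * apply Permutation_cons_app, P.
      * intros x [<-|Ix]; [split; assumption | auto].
    + exists (a :: l1), l2; split; [|split; [|exact H2]].
      * apply perm_skip, P.
      * intros x [<-|Ix]; [split; assumption | auto].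
Qed.

(** The induction removes the largest orbit. The new component lies above the previous maximum [u]
    and all earlier ones below it, so they are not connected; this is why the bound
    [snd p < u (fst p)] is carried along. *)
Lemma components_below_max n (l : list R) :
  length l = S n -> NoDup l -> (forall x, In x l -> nonzero_ic x) ->
  exists u ps, sol (abel A B C) in01 u /\ u 0 = u 1 /\ In (u 0) l /\
    (forall y, In y l -> y <= u 0) /\ length ps = n /\
    ForallOrdPairs (fun p q => ~ conn (zero_set f) p q) ps /\
    forall p, In p ps -> zero_set f p /\ joins01 (Defs.comp (zero_set f) p) /\
      snd p < u (fst p).
Proof.
  assert (I0 : in01 0) by (split; lra).
  revert l; induction n as [|n IH]; intros l Hl ND Hnz.
  - destruct l as [|x [|]]; try discriminate.
    destruct (Hnz x (or_introl eq_refl)) as [[u [Hu [u0 u1]]] _].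
    exists u, nil; rewrite u0, u1.
    split; [exact Hu|split; [reflexivity|split; [left; reflexivity|]]].
    split; [intros y [<-|[]]; lra|split; [reflexivity|split; [constructor|intros p []]]].
  - destruct (list_extract_max l) as [x [l' [P Hx]]]; [destruct l; discriminate|].
    assert (Hl' : length l' = S n).
    { apply Permutation_length in P; rewrite Hl in P; simpl in P; lia. }
    assert (ND' := Permutation_NoDup P ND). inversion ND' as [|? ? nx NDl' E]; subst.
    destruct (IH l' Hl' NDl') as [u [ps [Hu [Eu [Iu [Mu [Lps [Fps Hps]]]]]]]].
    { intros y Iy; apply Hnz. apply Permutation_in with (x :: l');
        [apply Permutation_sym, P | right; exact Iy]. }
    assert (Ix : In x l)
      by (apply Permutation_in with (x :: l'); [apply Permutation_sym, P | left; reflexivity]).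
    assert (Iul : In (u 0) l)
      by (apply Permutation_in with (x :: l'); [apply Permutation_sym, P | right; exact Iu]).
    destruct (Hnz x Ix) as [[v [Hv [v0 v1]]] Fv].
    destruct (Hnz (u 0) Iul) as [_ Fu].
    assert (uv : u 0 < v 0).
    { rewrite v0. destruct (Rle_lt_or_eq_dec (u 0) x (Hx _ Iu)) as [L|L]; [exact L|].
      rewrite L in Iu; contradiction. }
    destruct (nonzero_orbits_separated A B C f w HA HB HC Hf Hper M_nneg M_null M_zeros
      u v Hu Eu Hv) as [p [Zp [Jp [p1 p2]]]];
      [congruence | exact uv | exact Fu | rewrite v0; exact Fv |].
    exists v, (p :: ps).
    split; [exact Hv|split; [congruence|split; [rewrite v0; exact Ix|split; [|split; [|split]]]]].
    + intros y Iy; rewrite v0. apply (Permutation_in _ P) in Iy.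
      destruct Iy as [<-|Iy]; [lra | apply Hx; exact Iy].
    + simpl; congruence.
    + constructor; [|exact Fps]. apply Forall_forall; intros q Iq [K [cK [KZ [Kp Kq]]]].
      destruct (Hps q Iq) as [Zq [_ Hq]].
      assert (L : snd p < u (fst p)); [|lra].
      apply (connected2_one_side K u cK (sol_continuous01 _ _ Hu)).
      * intros r Kr; apply (KZ r Kr).
      * intros r Kr E; destruct (KZ r Kr) as [Ir Fr]. rewrite E in Fr.
        destruct (periodic_f_sign A B C f w HA HB HC Hf Hper M_nneg u Hu Eu _ Ir)
          as [_ [S1 S2]].
        destruct (Rdichotomy _ _ Fu) as [L|L]; [specialize (S2 L) | specialize (S1 L)]; lra.
      * exists q; auto.
      * exact Kp.
    + intros q [<-|Iq]; [auto|].
      destruct (Hps q Iq) as [Zq [Jq Hq]]; split; [exact Zq|split; [exact Jq|]].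
      apply Rlt_trans with (u (fst q)); [exact Hq|].
      apply (sol_order A B C); try assumption. apply Zq.
Qed.

Lemma zero_ic_comp x : zero_ic x ->
  exists u, sol (abel A B C) in01 u /\ u 0 = x /\ zero_set f (0, x) /\
    (forall p, Defs.comp (zero_set f) (0, x) p <-> graph u p) /\
    joins01 (Defs.comp (zero_set f) (0, x)).
Proof.
  intros [[u [Hu [u0 u1]]] Fx].
  assert (Eu : u 0 = u 1) by congruence.
  assert (Zu : forall t, in01 t -> f t (u t) = 0).
  { intros t Ht.
    apply (periodic_f_sign A B C f w HA HB HC Hf Hper M_nneg u Hu Eu t Ht); congruence. }
  exists u; split; [exact Hu|split; [exact u0|split; [|split]]].
  - split; simpl; [split; lra | exact Fx].
  - rewrite <- u0; apply (zero_orbit_comp A B C f w); assumption.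
  - rewrite <- u0; apply (zero_orbit_joins A B C f w); assumption.
Qed.

Lemma periodic_count K1 K2 :
  ncomp (zero_set f) joins01 K1 ->
  ncomp (zero_set f) (fun K => joins01 K /\ invariant (abel A B C) K) K2 ->
  forall l, NoDup l -> (forall x, In x l -> periodic_ic (abel A B C) x) ->
    (length l <= K1 + K2 + 1)%nat.
Proof.
  intros [r1 [<- [_ [_ R1]]]] [r2 [<- [_ [_ R2]]]] l ND H.
  destruct (split_ic l H) as [l1 [l2 [P [H1 H2]]]].
  assert (NDa := Permutation_NoDup P ND).
  assert (ND1 := NoDup_app_remove_r _ _ NDa). assert (ND2 := NoDup_app_remove_l _ _ NDa).
  rewrite (Permutation_length P), length_app.
  assert (B1 : (length l1 <= length r1 + 1)%nat).
  (* [n + 1] orbits off [{f = 0}] have [n] gaps, each with its own component: the source of the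
     [+ 1]. *)
  { destruct (length l1) as [|n] eqn:E; [lia|].
    destruct (components_below_max n l1 E ND1 H1)
      as [u [ps [_ [_ [_ [_ [Lps [Fps Hps]]]]]]]].
    assert (K := pigeonhole_conn (zero_set f) ps r1 Fps).
    rewrite Lps in K. enough (n <= length r1)%nat by lia. apply K.
    intros p Ip; destruct (Hps p Ip) as [Zp [Jp _]]. apply R1; assumption. }
  assert (B2 : (length l2 <= length r2)%nat).
  { rewrite <- (length_map (fun x => (0, x)) l2).
    apply pigeonhole_conn with (zero_set f).
    - clear - HA HB HC Hf Hper M_nneg M_null M_zeros ND2 H2.
      induction l2 as [|x l2 IH]; simpl; [constructor|].
      inversion ND2 as [|? ? nx ND2' E]; subst. constructor.
      + apply Forall_forall; intros q Iq Cq.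
        apply in_map_iff in Iq. destruct Iq as [y [<- Iy]].
        destruct (zero_ic_comp x (H2 x (or_introl eq_refl))) as [u [_ [u0 [_ [Cu _]]]]].
        apply Cu in Cq. destruct Cq as [_ Ey]; simpl in Ey. rewrite u0 in Ey; congruence.
      + apply IH; [intros y Iy; apply H2; right; exact Iy | exact ND2'].
    - intros p Ip. apply in_map_iff in Ip. destruct Ip as [x [<- Ix]].
      destruct (zero_ic_comp x (H2 x Ix)) as [u [Hu [u0 [Zx [Cu Jx]]]]].
      apply R2; [exact Zx|split; [exact Jx|]].
      destruct (graph_invariant A B C u HA HB HC Hu) as [G1 G2].
      split; [intros q Cq; apply G1, Cu, Cq|].
      intros I y Hy t0 t1 It0 It1 Cq. apply Cu, (G2 I y Hy t0 t1 It0 It1), Cu, Cq. }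
  lia.
Qed.

End Counting.

(** * Passing from [f] to [-f] *)

Lemma C1_2d_opp f : C1_2d f -> C1_2d (fun t x => - f t x).
Proof.
  intros Hf t x; destruct (Hf t x) as [H1 [H2 [H3 H4]]].
  split; [|split; [|split]].
  - apply (ex_derive_opp (fun s => f s x)); exact H1.
  - apply (ex_derive_opp (fun y => f t y)); exact H2.
  - apply continuous_ext with (fun p : R * R => - dt f (fst p) (snd p)).
    + intros p; unfold dt; symmetry; apply Derive_opp.
    + apply (continuous_opp (fun p : R * R => dt f (fst p) (snd p))); exact H3.
  - apply continuous_ext with (fun p : R * R => - dx f (fst p) (snd p)).
    + intros p; unfold dx; symmetry; apply Derive_opp.
    + apply (continuous_opp (fun p : R * R => dx f (fst p) (snd p))); exact H4.
Qed.

Lemma Mw_opp h f w t x : Mw h (fun t x => - f t x) w t x = - Mw h f w t x.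
Proof.
  unfold Mw.
  replace (dt (fun t x => - f t x) t x) with (- dt f t x)
    by (symmetry; apply (Derive_opp (fun s => f s x))).
  replace (dx (fun t x => - f t x) t x) with (- dx f t x)
    by (symmetry; apply (Derive_opp (fun y => f t y))).
  ring.
Qed.

(** An equality of predicates, so that the component counts [K1] and [K2] transfer by rewriting. *)
Lemma zero_set_opp f : zero_set (fun t x => - f t x) = zero_set f.
Proof.
  apply functional_extensionality; intros p; apply propositional_extensionality.
  unfold zero_set; split; intros [H1 H2]; (split; [exact H1 | lra]).
Qed.


Theorem theorem2p4 (A B C : R -> R) (f : R -> R -> R) (w : R) (K1 K2 : nat) :
  C1_on01 A -> C1_on01 B -> C1_on01 C ->
  C1_2d f -> periodic1 f ->
  (* M_w does not change sign in the strip *)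
  ((forall t x, in01 t -> 0 <= Mw (abel A B C) f w t x) \/
   (forall t x, in01 t -> Mw (abel A B C) f w t x <= 0)) ->
  (* its zero set has Lebesgue measure zero *)
  null2 (fun p => in01 (fst p) /\ Mw (abel A B C) f w (fst p) (snd p) = 0) ->
  (* its zero set is not invariant: it contains no invariant set other than
     (necessarily present) invariant subsets of {f = 0} *)
  (forall P, invariant (abel A B C) P -> 
     (forall p, P p -> Mw (abel A B C) f w (fst p) (snd p) = 0) ->
     forall p, P p -> f (fst p) (snd p) = 0) ->
  (* K1 curves of {f=0} joining t=0 and t=1, K2 of them invariant *)
  ncomp (fun p => in01 (fst p) /\ f (fst p) (snd p) = 0) joins01 K1 ->
  ncomp (fun p => in01 (fst p) /\ f (fst p) (snd p) = 0)
        (fun K => joins01 K /\ invariant (abel A B C) K) K2 ->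
  (forall l : list R, NoDup l -> (forall x0, In x0 l -> periodic_ic (abel A B C) x0) ->
     (length l <= K1 + K2 + 1)%nat) /\
  (forall u, sol (abel A B C) in01 u -> u 0 = u 1 ->
     (exists t, in01 t /\ f t (u t) <> 0) ->
     (forall t, in01 t -> f t (u t) <> 0) /\
     hyperbolic (abel A B C) (u 0) /\
     ((exists d, poincare_deriv (abel A B C) (u 0) d /\ d < 1) /\
        (forall t, in01 t -> w * f t (u t) * Mw (abel A B C) f w t (u t) <= 0) /\
        (exists t, in01 t /\ w * f t (u t) * Mw (abel A B C) f w t (u t) < 0)
      \/
      (exists d, poincare_deriv (abel A B C) (u 0) d /\ 1 < d) /\
        (forall t, in01 t -> 0 <= w * f t (u t) * Mw (abel A B C) f w t (u t)) /\
        (exists t, in01 t /\ 0 < w * f t (u t) * Mw (abel A B C) f w t (u t)))).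
Proof.
  intros HA HB HC Hf Hper Hsign Hnull Hinv HK1 HK2.
  apply C1_continuous01 in HA; apply C1_continuous01 in HB; apply C1_continuous01 in HC.
  destruct Hsign as [Hs|Hs].
  - split.
    + apply (periodic_count A B C f w); assumption.
    + intros u Hu Eu Hne; apply (periodic_orbit_stability A B C f w); assumption.
  - set (g := fun t x => - f t x).
    assert (Hg : C1_2d g) by (apply C1_2d_opp; exact Hf).
    assert (gper : periodic1 g) by (intros t x; unfold g; rewrite Hper; reflexivity).
    assert (gM : forall t x, Mw (abel A B C) g w t x = - Mw (abel A B C) f w t x)
      by (intros; apply Mw_opp).
    assert (gs : forall t x, in01 t -> 0 <= Mw (abel A B C) g w t x)
      by (intros t x Ht; rewrite gM; specialize (Hs t x Ht); lra).
    assert (gnull : null2 (fun p => in01 (fst p) /\ Mw (abel A B C) g w (fst p) (snd p) = 0)).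
    { apply null2_subset with (2 := Hnull); intros p [Hp E]; rewrite gM in E.
      split; [exact Hp | lra]. }
    assert (ginv : forall P, invariant (abel A B C) P ->
      (forall p, P p -> Mw (abel A B C) g w (fst p) (snd p) = 0) ->
      forall p, P p -> g (fst p) (snd p) = 0).
    { intros P HP HM p Pp; unfold g; rewrite (Hinv P HP); [ring| |exact Pp].
      intros q Pq; specialize (HM q Pq); rewrite gM in HM; lra. }
    split.
    + apply (periodic_count A B C g w); try assumption;
        unfold g; rewrite zero_set_opp; assumption.
    + intros u Hu Eu [t0 [Ht0 F0]].
      destruct (periodic_orbit_stability A B C g w HA HB HC Hg gper gs ginv u Hu Eu)
        as [N [H D]].
      { exists t0; split; [exact Ht0 | unfold g; lra]. }
      (* The two changes of sign cancel, so the stability criterion is the same for [g] and [f]. *)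
      assert (E : forall t, w * g t (u t) * Mw (abel A B C) g w t (u t) =
        w * f t (u t) * Mw (abel A B C) f w t (u t)) by (intros; rewrite gM; unfold g; ring).
      split; [intros t Ht Z; apply (N t Ht); unfold g; lra|split; [exact H|]].
      destruct D as [[D1 [D2 [t [Ht D3]]]]|[D1 [D2 [t [Ht D3]]]]]; [left|right];
        (split; [exact D1|split; [intros s Is; rewrite <- E; apply D2; exact Is|]]);
        exists t; split; try exact Ht; rewrite <- E; exact D3.
Qed.
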